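(* For any $\delta\in(0,1)$, with probability at least $1-\delta$, on the event $\mathcal E_{\bar U}$ both $\|\mathbf K\,\mathsf{ridge}(\bar{\mathbf U}G_\star^\top,\mu)^\top\|_{\mathrm{op}}$ and $\mu\|\mathsf{ridge}(\bar{\mathbf U}G_\star^\top,\mu)^\top\|_{\mathrm{op}}$ are $\lesssim\mathsf{Ovfit}_\mu(\delta)$.
   Context: Semi-parametric setting: integers $p,m,T,\bar L\ge1$, $1\le N_1\le N$; $\{\mathcal F_t\}$ a filtration; $\mathbf u_t\in\mathbb R^p$ $\mathcal F_t$-measurable with $\mathbf u_t\mid\mathcal F_{t-1}\sim\mathcal N(0,I_p)$; $\bar{\mathbf u}_t:=[\mathbf u_t^\top|\dots|\mathbf u_{t-T+1}^\top]^\top$; $G_\star\in\mathbb R^{m\times Tp}$ fixed; features $\mathbf k_t\in\mathbb R^{\bar L}$ are $\mathcal F_{t-T}$-measurable. $\bar{\mathbf U},\mathbf K$ have rows $\bar{\mathbf u}_t^\top$, $\mathbf k_t^\top$ for $t=N_1,\dots,N$. For $\mathbf A$ with $N-N_1+1$ rows and $\mu>0$, $\mathsf{ridge}(\mathbf A,\mu):=\arg\min_{\phi\in\mathbb R^{m\times\bar L}}\|\mathbf K\phi^\top-\mathbf A\|_F^2+\mu^2\|\phi\|_F^2$. $\mathcal E_{\bar U}:=\{\frac N2I\preceq\bar{\mathbf U}^\top\bar{\mathbf U}\preceq2NI\}$. $\tilde p:=p\min\{T,\log^2(eTp)\log^2(Tp)\}$ and $\mathsf{Ovfit}_\mu(\delta):=\|G_\star\|_{\mathrm{op}}\min\{N^{1/2},T^{1/2}\sqrt{\log\frac1\delta+\tilde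 p+\log\det(I+\mu^{-2}\mathbf K\mathbf K^\top)^{1/2}}\}$. $\lesssim$ hides universal constants. *)

(* Defs.v *)
From HB Require Import structures.
From mathcomp Require Import all_boot all_order all_algebra.
From mathcomp Require Import all_classical all_reals all_analysis.
From mathcomp Require Import normal_distribution.
Set Implicit Arguments. Unset Strict Implicit. Unset Printing Implicit Defensive.
Import Order.TTheory GRing.Theory Num.Theory.
Local Open Scope classical_set_scope.
Local Open Scope ring_scope.

Section Defs.
Context {R : realType}.

Definition vnorm {n} (x : 'cV[R]_n) : R := Num.sqrt (\sum_i x i 0 ^+ 2).

Definition opnorm {m n} (A : 'M[R]_(m, n)) : R :=
  sup [set vnorm (A *m x) | x in [set x : 'cV[R]_n | vnorm x = 1]].

Definition frob2 {m n} (A : 'M[R]_(m, n)) : R := \sum_i \sum_j A i j ^+ 2.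

Definition psd {n} (A : 'M[R]_n) : Prop := forall x : 'cV[R]_n, 0 <= (x^T *m A *m x) 0 0.
Definition loewner_le {n} (A B : 'M[R]_n) : Prop := psd (B - A).

Definition ridge_obj {M L m} (K : 'M[R]_(M, L)) (A : 'M[R]_(M, m)) (mu : R)
  (phi : 'M[R]_(m, L)) : R := frob2 (K *m phi^T - A) + mu ^+ 2 * frob2 phi.

Definition is_ridge {M L m} (K : 'M[R]_(M, L)) (A : 'M[R]_(M, m)) (mu : R)
  (phi : 'M[R]_(m, L)) : Prop := forall psi, ridge_obj K A mu phi <= ridge_obj K A mu psi.

Definition ptilde (p T : nat) : R :=
  p%:R * Num.min T%:R (ln (expR 1 * (T * p)%:R) ^+ 2 * ln ((T * p)%:R) ^+ 2).

Definition Ovfit {M m n} (G : 'M[R]_(m, n)) (N T p : nat) (K : 'M[R]_M) (mu delta : R) : R :=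
  opnorm G * Num.min (Num.sqrt N%:R)
    (Num.sqrt T%:R * Num.sqrt (ln (delta^-1) + ptilde p T
        + ln (Num.sqrt (\det (1%:M + mu ^- 2 *: K))))).

End Defs.

Section Prob.
Context {R : realType} {d : measure_display} {Omega : measurableType d}.

Definition Gmeas (G : set (set Omega)) (f : Omega -> R) : Prop :=
  forall B : set R, measurable B -> G (f @^-1` B).

Definition filtration (F : int -> set (set Omega)) : Prop :=
  (forall t, sigma_algebra setT (F t)) /\ (forall t, F t `<=` measurable) /\
  (forall s t, (s <= t)%R -> F s `<=` F t).

(* conditional law of v given G is N(0, I_p): for every A in G and Borel
   rectangle B_0 x ... x B_(p-1),
   P(A /\ v in B) = P(A) * prod_l N(0,1)(B_l) *)
Definition cond_std_gauss (P : probability Omega R) (G : set (set Omega)) {p : nat}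
  (v : Omega -> 'rV[R]_p) : Prop :=
  forall A, G A -> forall B : 'I_p -> set R, (forall l, measurable (B l)) ->
    P (A `&` [set w | forall l, B l (v w 0 l)]) =
    (P A * \prod_(l < p) normal_prob 0 1 (B l))%E.

Definition Ubar {p} (u : int -> Omega -> 'rV[R]_p) (T N1 N : nat) (w : Omega)
  : 'M[R]_((N - N1).+1, T * p) :=
  \matrix_(i < (N - N1).+1)
     mxvec (\matrix_(s < T, l < p) u ((N1 + i)%:Z - s%:Z)%R w 0 l).

Definition Kmat {L} (k : int -> Omega -> 'rV[R]_L) (N1 N : nat) (w : Omega)
  : 'M[R]_((N - N1).+1, L) :=
  \matrix_(i < (N - N1).+1) k (N1 + i)%:Z w.

End Prob.

(* Main.v *)
Require Import Defs.
From HB Require Import structures.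
From mathcomp Require Import all_boot all_order all_algebra.
From mathcomp Require Import all_classical all_reals all_analysis.
From mathcomp Require Import normal_distribution.
From mathcomp Require Import measurable_realfun.
From mathcomp Require Import ring lra.
Set Implicit Arguments. Unset Strict Implicit. Unset Printing Implicit Defensive.
Import Order.TTheory GRing.Theory Num.Theory.
Local Open Scope classical_set_scope.
Local Open Scope ring_scope.

(** For a direction [x], put [y = mu phi^T x] and [V = 1 + mu^-2 K^T K]. The
    normal equations give [V y = mu^-1 K^T U g] with [g = Gs^T x], and
    [y^T V y = |K phi^T x|^2 + mu^2 |phi^T x|^2], so both norms are controlled
    by this energy. It is at most [|U g|^2], which yields the [sqrt N] branch.

    For the other branch split [U g] over the [T] lags. Since [k_t] is
    measurable with respect to [F_(t-T)], each lag [s] and unit direction [z]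
    give a self-normalized Gaussian martingale, for which
    [exp (S^T V^-1 S / 2) / sqrt (det V)] has expectation exactly 1: a rank-one
    update multiplies it by the likelihood ratio of [N(a, 1 + b)] to [N(0, 1)].
    Mixing over a weighted finite net of directions costs [O(p - 1)] in the
    exponent; this vanishes for [p = 1], where [ptilde] may be zero. Averaging
    over the lags before applying Markov's inequality, and then using the
    concavity of [ln], avoids a union bound over [T]. *)

(** * Rank-one updates of positive definite matrices *)

Section Algebra.
Variable R : realType.

(** Sylvester's identity: one block matrix is factored as lower times upper and as upper times
    lower, and the two determinants are compared. *)
Lemma det_addmul_comm (m n : nat) (A : 'M[R]_(m, n)) (B : 'M[R]_(n, m)) :
  \det (1%:M + A *m B) = \det (1%:M + B *m A).
Proof.
have e1 : block_mx 1%:M (- A) B 1%:M =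
    block_mx 1%:M 0 B 1%:M *m block_mx 1%:M (- A) 0 (1%:M + B *m A).
  by rewrite mulmx_block !mul1mx !mul0mx !mulmx1 ?mulmx0 !addr0 mulmxN addrC addrK.
have e2 : block_mx 1%:M (- A) B 1%:M =
    block_mx 1%:M (- A) 0 1%:M *m block_mx (1%:M + A *m B) 0 B 1%:M.
  by rewrite mulmx_block !mul1mx !mul0mx !mulmx1 ?mulmx0 !add0r mulNmx addrK.
have := e1; rewrite e2 => /(congr1 determinant).
by rewrite !det_mulmx !det_ublock !det_lblock !det1 !mul1r mulr1.
Qed.

(* [V >= 1] in the Loewner order; the determinant bound would follow from it, but
   is carried along because it is immediate under rank-one updates. *)
Definition posdef n (V : 'M[R]_n) := [/\ V^T = V, psd (V - 1%:M) & 1 <= \det V].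

Definition qf n (A : 'M[R]_n) (x : 'cV[R]_n) : R := (x^T *m A *m x) 0 0.

Lemma sqn_ge0 n (x : 'cV[R]_n) : 0 <= (x^T *m x) 0 0.
Proof. by rewrite mxE sumr_ge0// => i _; rewrite mxE -expr2 sqr_ge0. Qed.

Lemma posdef1 n : posdef (1%:M : 'M[R]_n).
Proof. by split; [rewrite trmx1|move=> x; rewrite subrr mulmx0 mul0mx mxE|rewrite det1]. Qed.

Lemma posdef_sqn n (V : 'M[R]_n) (x : 'cV[R]_n) : posdef V -> (x^T *m x) 0 0 <= qf V x.
Proof.
move=> [_ h _]; have := h x; rewrite mulmxBr mulmx1 mulmxBl mxE [X in _ + X]mxE.
by rewrite subr_ge0.
Qed.

Lemma qf_rank1 n (k x : 'cV[R]_n) : qf (k *m k^T) x = (k^T *m x) 0 0 ^+ 2.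
Proof.
rewrite /qf !mulmxA -mulmxA.
have -> : x^T *m k = (k^T *m x)^T by rewrite trmx_mul trmxK.
by rewrite [LHS]mxE big_ord1 mxE expr2.
Qed.

Lemma posdef_det_gt0 n (V : 'M[R]_n) : posdef V -> 0 < \det V.
Proof. by move=> [_ _]; exact: lt_le_trans. Qed.

Lemma posdef_unit n (V : 'M[R]_n) : posdef V -> V \in unitmx.
Proof. by move=> /posdef_det_gt0 d0; rewrite unitmxE unitfE gt_eqF. Qed.

Lemma posdef_inv_sym n (V : 'M[R]_n) : posdef V -> (invmx V)^T = invmx V.
Proof. by move=> [s _ _]; rewrite trmx_inv s. Qed.

Lemma qf_invE n (V : 'M[R]_n) (x : 'cV[R]_n) : posdef V -> qf (invmx V) x = qf V (invmx V *m x).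
Proof.
move=> pV; rewrite /qf trmx_mul posdef_inv_sym// !mulmxA mulmxKV//.
exact: posdef_unit.
Qed.

Lemma qf_inv_ge0 n (V : 'M[R]_n) (x : 'cV[R]_n) : posdef V -> 0 <= qf (invmx V) x.
Proof.
by move=> pV; rewrite qf_invE// (le_trans _ (posdef_sqn _ pV))// sqn_ge0.
Qed.

(** The matrix determinant lemma: after factoring out [V], Sylvester's identity leaves a 1 by 1
    determinant. *)
Lemma det_rank1 n (V : 'M[R]_n) (k : 'cV[R]_n) : posdef V ->
  \det (V + k *m k^T) = \det V * (1 + qf (invmx V) k).
Proof.
move=> pV; have uV := posdef_unit pV.
have -> : V + k *m k^T = V *m (1%:M + invmx V *m k *m k^T).
  by rewrite mulmxDr mulmx1 !mulmxA mulmxV// mul1mx.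
rewrite det_mulmx det_addmul_comm det_mx11 mxE mulmxA; congr (_ * (_ + _)).
by rewrite mxE.
Qed.

Lemma posdef_rank1 n (V : 'M[R]_n) (k : 'cV[R]_n) : posdef V -> posdef (V + k *m k^T).
Proof.
move=> pV; have [s h d0] := pV.
split; first by rewrite linearD/= trmx_mul trmxK s.
  move=> x; rewrite addrAC mulmxDr mulmxDl mxE addr_ge0//.
  by rewrite -/(qf _ _) qf_rank1 sqr_ge0.
by rewrite det_rank1// mulr_ege1// lerDl qf_inv_ge0.
Qed.

(** The Sherman-Morrison formula, verified by multiplying both sides by [V + k *m k^T]. *)
Lemma invmx_rank1 n (V : 'M[R]_n) (k : 'cV[R]_n) : posdef V ->
  invmx (V + k *m k^T) = invmx V -
    (1 + qf (invmx V) k)^-1 *: (invmx V *m k *m (invmx V *m k)^T).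
Proof.
move=> pV; have uV := posdef_unit pV; have pV' := posdef_rank1 k pV.
have uV' := posdef_unit pV'; set W := invmx V; set b := qf W k.
have b1 : 1 + b != 0 by rewrite gt_eqF// ltr_wpDr// qf_inv_ge0.
apply: (can_inj (mulKmx uV')); rewrite mulmxV//.
have sW : W^T = W by exact: posdef_inv_sym.
have kWk : k^T *m W *m k = b%:M by rewrite [LHS]mx11_scalar.
rewrite mulmxBr mulmxDl mulmxV// -scalemxAr -[k *m k^T *m W]mulmxA.
rewrite trmx_mul sW mulmxDl !mulmxA mulmxV// mul1mx.
have -> : k *m k^T *m W *m k *m k^T *m W = b *: (k *m k^T *m W).
  by rewrite -(mulmxA k) -(mulmxA k) kWk -scalemx1 -scalemxAr mulmx1 -!scalemxAl !mulmxA.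
rewrite -{2}[k *m k^T *m W]scale1r -scalerDl scalerA mulVf// scale1r addrK//.
Qed.

(** The increment is twice the quadratic exponent of the likelihood ratio [tilt a b h]: it is
    [2 a h + b h^2] minus the Sherman-Morrison correction [(a + h b)^2 / (1 + b)]. *)
Lemma qf_inv_rank1 n (V : 'M[R]_n) (k S : 'cV[R]_n) (h : R) : posdef V ->
  let a := (k^T *m invmx V *m S) 0 0 in let b := qf (invmx V) k in
  qf (invmx (V + k *m k^T)) (S + h *: k) =
    qf (invmx V) S + (2 * (a * h) + b * h ^+ 2 - a ^+ 2) / (1 + b).
Proof.
move=> pV a b; have b1 : 1 + b != 0 by rewrite gt_eqF// ltr_wpDr// qf_inv_ge0.
rewrite invmx_rank1// -/b; set W := invmx V.
have sW : W^T = W by exact: posdef_inv_sym.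
have aE : (S^T *m W *m k) 0 0 = a.
  have -> : S^T *m W *m k = (k^T *m W *m S)^T by rewrite !trmx_mul trmxK sW mulmxA.
  by rewrite mxE.
have kx : ((W *m k)^T *m (S + h *: k)) 0 0 = a + h * b.
  by rewrite trmx_mul sW mulmxDr -scalemxAr mxE [X in _ + X]mxE.
rewrite /qf mulmxBr mulmxBl mxE [X in _ + X]mxE -scalemxAr -scalemxAl.
rewrite [in X in _ - X]mxE.
have -> : ((S + h *: k)^T *m (W *m k *m (W *m k)^T) *m (S + h *: k)) 0 0 = (a + h * b) ^+ 2.
  by rewrite -/(qf _ _) qf_rank1 kx.
have -> : ((S + h *: k)^T *m W *m (S + h *: k)) 0 0 = qf W S + a * h *+ 2 + b * h ^+ 2.
  have -> : (S + h *: k)^T = S^T + h *: k^T by rewrite linearD linearZ.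
  rewrite !mulmxDl !mulmxDr -!scalemxAl -!scalemxAr.
  rewrite !mxE; move: aE; rewrite mxE => ->.
  rewrite -/(qf W S) /a /qf /b /qf !mxE; ring.
rewrite -/(qf W S); field; exact: b1.
Qed.

End Algebra.

(** * The Gaussian change of measure *)

Section GaussStep.
Context {R : realType} {d : measure_display} {Omega : measurableType d}.
Variable P : probability Omega R.
Implicit Types (G : set (set Omega)).

(** Turns [Gmeas] into measurability on the generated type, where the closure properties of
    measurable functions apply. *)
Lemma GmeasP G (f : Omega -> R) : sigma_algebra setT G ->
  Gmeas G f <-> measurable_fun setT (f : g_sigma_algebraType G -> R).
Proof.
move=> sG; have GE := measurable_g_measurableTypeE sG; split.
  by move=> mf _ B mB; rewrite setTI GE; exact: mf.
by move=> mf B mB; rewrite -GE -[_ @^-1` _]setTI; exact: mf.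
Qed.

Lemma Gmeas_measurable G (f : Omega -> R) :
  G `<=` measurable -> Gmeas G f -> measurable_fun setT f.
Proof. by move=> Gm mf _ B mB; rewrite setTI; apply: Gm; exact: mf. Qed.

(** Writing [1 / f] as [f * exp (- ln (f^2))] leaves only known measurable maps; at a zero of [f]
    both are 0 because [0^-1 = 0]. *)
Lemma measurable_fun_inv d' (T : measurableType d') (f : T -> R) :
  measurable_fun setT f -> measurable_fun setT (fun x => (f x)^-1).
Proof.
move=> mf.
have -> : (fun x => (f x)^-1) = (fun x => f x * expR (- ln (f x ^+ 2))).
  apply/funext => x /=; have [->|f0] := eqVneq (f x) 0; first by rewrite invr0 mul0r.
  rewrite expRN lnK ?posrE ?exprn_even_gt0//.
  by rewrite expr2 invfM mulrA mulfV// mul1r.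
apply: measurable_funM => //; apply: measurableT_comp => //.
apply: measurableT_comp => //; apply: (measurableT_comp (@measurable_ln R)).
exact: measurable_funX.
Qed.

(** The Radon-Nikodym derivative of the normal law agrees almost everywhere with the density, since
    both have the same integral over every measurable set. *)
Lemma integral_normal_prob (m s : R) (f : R -> \bar R) :
  (forall x, 0 <= f x)%E -> measurable_fun setT f ->
  (\int[normal_prob m s]_x f x =
   \int[lebesgue_measure]_x (f x * (normal_pdf m s x)%:E))%E.
Proof.
move=> f0 mf; have dom := normal_prob_dominates m s.
rewrite -(Radon_Nikodym_SigmaFinite.change_of_variables dom f0 measurableT mf).
have mpdf : measurable_fun setT (fun x => (normal_pdf m s x)%:E).
  by apply/measurable_EFinP; exact: measurable_normal_pdf.
have idn := Radon_Nikodym_SigmaFinite.f_integrable dom.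
apply: ae_eq_integral => //.
- by apply: emeasurable_funM => //; exact: measurable_int idn.
- exact: emeasurable_funM.
- apply: ae_eqe_mul2l; apply: integral_ae_eq => // E _ mE.
  by rewrite -(Radon_Nikodym_SigmaFinite.f_integral dom mE).
Qed.

Definition tilt (a b y : R) : R :=
  expR ((2 * (a * y) + b * y ^+ 2 - a ^+ 2) / (2 * (1 + b))) * expR (- (ln (1 + b) / 2)).

Lemma tilt_ge0 a b y : 0 <= tilt a b y.
Proof. by rewrite mulr_ge0// expR_ge0. Qed.

(* The tilt is the likelihood ratio of N(a, 1 + b) with respect to N(0, 1). *)
Lemma tilt_pdf a b y : 0 <= b ->
  tilt a b y * normal_pdf 0 1 y = normal_pdf a (Num.sqrt (1 + b)) y.
Proof.
move=> b0; have b1 : 0 < 1 + b by rewrite ltr_wpDr.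
have sb0 : Num.sqrt (1 + b) != 0 by rewrite gt_eqF// sqrtr_gt0.
rewrite !normal_pdfE//= /tilt /normal_fun /normal_peak.
rewrite sqr_sqrtr ?(ltW b1)// expr1n mul1r -[(1 + b) * pi *+ 2]mulrnAr sqrtrM ?(ltW b1)//.
have -> : expR (- (ln (1 + b) / 2)) = (Num.sqrt (1 + b))^-1.
  rewrite expRN; congr (_^-1); apply/eqP.
  rewrite -(@eqrXn2 _ 2)// ?expR_ge0 ?sqrtr_ge0// sqr_sqrtr ?(ltW b1)//.
  by rewrite -expRM_natr mulr_natr -mulr_natr divfK// lnK ?posrE.
set s1 := (Num.sqrt (1 + b))^-1; set q := (Num.sqrt (pi *+ 2))^-1.
set e3 := expR (- (y - a) ^+ 2 / _).
set e1 := expR _; set e2 := expR _.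
(* Completing the square: [-(y - a)^2 / (2 (1 + b))] is the exponent of the tilt minus [y^2 / 2]. *)
have -> : e3 = e1 * e2.
  by rewrite /e1 /e2 /e3 -expRD; congr expR; field; rewrite gt_eqF.
by rewrite invfM -/s1 -/q; ring.
Qed.

Lemma measurable_tilt a b : measurable_fun setT (tilt a b).
Proof.
apply: measurable_funM => //; apply: measurableT_comp => //.
apply: measurable_funM => //; apply: measurable_funB => //.
apply: measurable_funD.
  by apply: measurable_funM => //; exact: measurable_funM.
by apply: measurable_funM => //; exact: measurable_funX.
Qed.

Lemma integral_tilt a b : 0 <= b ->
  (\int[normal_prob 0 1]_y (tilt a b y)%:E = 1)%E.
Proof.
move=> b0; rewrite integral_normal_prob; first last.
- by apply/measurable_EFinP; exact: measurable_tilt.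
- by move=> x; rewrite lee_fin tilt_ge0.
rewrite -[RHS](integral_normal_pdf a (Num.sqrt (1 + b))).
by apply: eq_integral => y _; rewrite -EFinM tilt_pdf.
Qed.

Definition cond_gauss1 G (h : Omega -> R) := forall A, G A ->
  forall B, measurable B -> P (A `&` h @^-1` B) = (P A * normal_prob 0 1 B)%E.

(* Both sides are integrals against the law of (w, h w) on the product of
   (Omega, G) and (T, measurable), which is a product measure. *)
Lemma integral_cond_indep d' (T : measurableType d') (Q : probability T R) G
    (h : Omega -> T) (g : g_sigma_algebraType G * T -> \bar R) :
  sigma_algebra setT G -> G `<=` measurable -> measurable_fun setT h ->
  (forall A B, G A -> measurable B -> P (A `&` h @^-1` B) = (P A * Q B)%E) ->
  measurable_fun setT g ->
  (forall x, 0 <= g x)%E ->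
  (\int[P]_w g (w, h w) = \int[P]_w \int[Q]_y g (w, y))%E.
Proof.
move=> sG Gm mh ch mg g0.
have GE := measurable_g_measurableTypeE sG.
pose TG := g_sigma_algebraType G.
have mid : measurable_fun setT (idfun : Omega -> TG).
  by move=> _ A mA; rewrite setTI; apply: Gm; rewrite -GE.
pose idm : {mfun Omega >-> TG} := HB.pack (idfun : Omega -> TG)
  (isMeasurableFun.Build _ _ _ _ _ mid).
have mpair : measurable_fun setT (fun w => (idm w, h w) : (TG * T)%type).
  by apply: measurable_fun_pair.
pose jm : {mfun Omega >-> (TG * T)%type} :=
  HB.pack (fun w => (idm w, h w) : (TG * T)%type)
  (isMeasurableFun.Build _ _ _ _ _ mpair).
pose PG : probability TG R := distribution P idm.
pose nu : probability (TG * T)%type R := distribution P jm.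
have mF := measurable_fun_fubini_tonelli_F (m2 := Q) _ mg g0.
transitivity (\int[nu]_x g x)%E.
  by rewrite /nu /= /distribution ge0_integral_pushforward.
transitivity (\int[PG]_x fubini_F Q g x)%E; last first.
  rewrite /PG /= /distribution ge0_integral_pushforward//.
  by move=> x _; apply: integral_ge0.
rewrite -fubini_tonelli1//.
(* The joint law is identified with the product measure on rectangles, where the independence
   hypothesis gives the product. *)
apply: eq_measure_integral => X mX _; apply/esym.
apply: product_measure_unique => // A B mA mB.
by rewrite /nu /PG /= /distribution /pushforward /= -ch // -GE.
Qed.

(** One martingale step: conditionally on [G] the values of [Z], [a] and [b] are frozen, and the
    tilt integrates to 1 against the normal law of [h]. *)
Lemma integral_tilt_cond G (h Z a b : Omega -> R) :
  sigma_algebra setT G -> G `<=` measurable ->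
  measurable_fun setT h -> cond_gauss1 G h ->
  Gmeas G Z -> Gmeas G a -> Gmeas G b ->
  (forall w, 0 <= Z w) -> (forall w, 0 <= b w) ->
  (\int[P]_w (Z w * tilt (a w) (b w) (h w))%:E = \int[P]_w (Z w)%:E)%E.
Proof.
move=> sG Gm mh ch mZ ma mb Z0 b0.
move/(GmeasP _ sG) : mZ => mZ; move/(GmeasP _ sG) : ma => ma.
move/(GmeasP _ sG) : mb => mb.
pose TG := g_sigma_algebraType G.
pose g (x : TG * R) : \bar R := (Z x.1 * tilt (a x.1) (b x.1) x.2)%:E.
have mg : measurable_fun setT g.
  have m1 (f : TG -> R) : measurable_fun setT f ->
      measurable_fun setT (fun x : TG * R => f x.1).
    by move=> mf; apply: (measurableT_comp mf); exact: measurable_fst.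
  have m2 : measurable_fun setT (fun x : TG * R => x.2) by exact: measurable_snd.
  apply/measurable_EFinP; apply: measurable_funM; first exact: m1.
  apply: measurable_funM; last first.
    apply: measurableT_comp => //; apply: measurableT_comp => //.
    apply: measurable_funM => //; apply: measurableT_comp => //.
    by apply: measurable_funD => //; exact: m1.
  apply: measurableT_comp => //; apply: measurable_funM.
    apply: measurable_funB; last by apply: measurable_funX; exact: m1.
    apply: measurable_funD.
      apply: measurable_funM => //.
      by apply: measurable_funM => //; exact: m1.
    by apply: measurable_funM; [exact: m1|exact: measurable_funX].
  apply: (measurable_fun_inv (f := fun x : TG * R => 2 * (1 + b x.1))).
  by apply: measurable_funM => //; apply: measurable_funD => //; exact: m1.
have g0 x : (0 <= g x)%E by rewrite lee_fin mulr_ge0// tilt_ge0.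
rewrite (@integral_cond_indep _ _ (normal_prob 0 1) G h g)//; last first.
  by move=> A B GA mB; exact: ch.
apply: eq_integral => x _; rewrite /g /=.
under eq_integral do rewrite EFinM.
rewrite ge0_integralZl//.
- by rewrite integral_tilt// mule1.
- by apply/measurable_EFinP; exact: measurable_tilt.
- by move=> y _; rewrite lee_fin tilt_ge0.
- by rewrite lee_fin.
Qed.

End GaussStep.

(** * The coordinates of a Gaussian vector, revealed one at a time *)

Section CoordinateFiltration.
Context {R : realType} {d : measure_display} {Omega : measurableType d}.
Variable P : probability Omega R.
Variables (p : nat) (G : set (set Omega)) (v : Omega -> 'rV[R]_p).
Hypothesis sG : sigma_algebra setT G.
Hypothesis Gm : G `<=` measurable.
Hypothesis mv : forall j, measurable_fun setT (fun w => v w 0 j).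

(** A pi-system generating the information in [G] and the first [l] coordinates, on which two finite
    measures can be compared. *)
Definition coord_rects (l : nat) : set (set Omega) :=
  [set X | exists A (B : 'I_p -> set R), [/\ G A, forall j, measurable (B j) &
    X = A `&` [set w | forall j : 'I_p, (j < l)%N -> B j (v w 0 j)]]].

Definition coord_sigma (l : nat) : set (set Omega) := <<s coord_rects l >>.

Lemma coord_sigma_algebra l : sigma_algebra setT (coord_sigma l).
Proof. exact: smallest_sigma_algebra. Qed.

Lemma measurable_rect (Q : pred 'I_p) (B : 'I_p -> set R) :
  (forall j, measurable (B j)) ->
  measurable [set w | forall j : 'I_p, Q j -> B j (v w 0 j)].
Proof.
move=> mB; have -> : [set w | forall j : 'I_p, Q j -> B j (v w 0 j)] =
    \bigcap_(j in [set j | Q j]) ((fun w => v w 0 j) @^-1` B j).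
  by apply/seteqP; split => w /= h j; exact: h.
apply: fin_bigcap_measurable; first exact: finite_finset.
by move=> j _; rewrite -[X in measurable X]setTI; exact: mv.
Qed.

Lemma coord_rects_measurable l : coord_rects l `<=` measurable.
Proof.
move=> _ [A [B [GA mB ->]]]; apply: measurableI; first exact: Gm.
exact: (measurable_rect (fun j : 'I_p => (j < l)%N)).
Qed.

Lemma coord_sigma_measurable l : coord_sigma l `<=` measurable.
Proof.
by apply: smallest_sub; [exact: sigma_algebra_measurable|
  exact: coord_rects_measurable].
Qed.

Lemma Gmeas_coord_sigma l (f : Omega -> R) : Gmeas G f -> Gmeas (coord_sigma l) f.
Proof.
move=> mf B mB; apply: sub_sigma_algebra; exists (f @^-1` B), (fun=> setT).
by split => //; [exact: mf|apply/seteqP; split => w //= []].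
Qed.

Lemma coord_sigma_coord l (j : 'I_p) : (j < l)%N ->
  Gmeas (coord_sigma l) (fun w => v w 0 j).
Proof.
move=> jl B mB; apply: sub_sigma_algebra.
exists setT, (fun i => if i == j then B else setT); split.
- by have [_ hC _] := sG; have [h0 _ _] := sG; have := hC _ h0; rewrite setD0.
- by move=> i; case: ifP.
- rewrite setTI; apply/seteqP; split => w /=.
    by move=> h i il; case: eqP => // ->.
  by move=> /(_ j jl); rewrite eqxx.
Qed.

(** For fixed [C], both sides are finite measures in the event; they agree on the pi-system of
    rectangles by independence of the coordinates, hence on the sigma-algebra it generates. *)
Lemma cond_gauss_coord (l : 'I_p) : cond_std_gauss P G v ->
  cond_gauss1 P (coord_sigma l) (fun w => v w 0 l).
Proof.
move=> cv X GX C mC.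
have Nfin : normal_prob 0 1 C \is a fin_num by exact: fin_num_measure.
have c0 : 0 <= fine (normal_prob (0 : R) 1 C) by rewrite fine_ge0.
have mC' : measurable ((fun w => v w 0 l) @^-1` C).
  by rewrite -[X in measurable X]setTI; exact: mv.
pose m1 : {measure set Omega -> \bar R} := mrestr P mC'.
pose m2 : {measure set Omega -> \bar R} := mscale (NngNum c0) P.
have GT : G setT.
  by have [h0 hC _] := sG; have := hC _ h0; rewrite setD0.
suff : m1 X = m2 X by rewrite /m1 /m2 /= /mrestr /mscale /= fineK// muleC.
apply: (@g_sigma_algebra_measure_unique _ R Omega (coord_rects l) _ (fun=> setT)) => //.
- exact: coord_rects_measurable.
- by move=> _; exists setT, (fun=> setT); split => //; apply/seteqP; split.
- by rewrite bigcup_const.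
- move=> _ _ [A [B [GA mB ->]]] [A' [B' [GA' mB' ->]]].
  exists (A `&` A'), (fun j => B j `&` B' j); split.
  + rewrite -(measurable_g_measurableTypeE sG); apply: measurableI;
      by rewrite measurable_g_measurableTypeE.
  + by move=> j; exact: measurableI.
  + apply/seteqP; split => w /= [].
      by move=> [? hB] [? hB']; split => // j jl; split; [exact: hB|exact: hB'].
    by move=> [? ?] h; split; split => // j /h [].
- move=> _ [A [B [GA mB ->]]].
  rewrite /m1 /m2 /= /mrestr /mscale /= fineK//.
  (* Full rectangles are needed to invoke [cond_std_gauss]: [B1] fills the unrevealed coordinates
     with the whole line, and [B2] puts [C] at position [l]. *)
  pose B1 (j : 'I_p) := if (j < l)%N then B j else setT.
  pose B2 (j : 'I_p) := if j == l then C else B1 j.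
  have mB1 j : measurable (B1 j) by rewrite /B1; case: ifP.
  have mB2 j : measurable (B2 j) by rewrite /B2; case: ifP.
  have -> : A `&` [set w | forall j : 'I_p, (j < l)%N -> B j (v w 0 j)] =
      A `&` [set w | forall j, B1 j (v w 0 j)].
    congr (_ `&` _); apply/seteqP; split => w /= h j; rewrite /B1.
      by case: ifP => // jl; exact: h.
    by move=> jl; have := h j; rewrite /B1 jl.
  have -> : A `&` [set w | forall j, B1 j (v w 0 j)] `&` (fun w => v w 0 l) @^-1` C =
      A `&` [set w | forall j, B2 j (v w 0 j)].
    rewrite -setIA; congr (_ `&` _); apply/seteqP; split => w /=.
      by move=> [h1 h2] j; rewrite /B2; case: eqP => [->//|_]; exact: h1.
    move=> h; split; last by have := h l; rewrite /B2 eqxx.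
    move=> j; have := h j; rewrite /B2; case: eqP => // -> _.
    by rewrite /B1 ltnn.
  rewrite !cv// muleCA; congr (_ * _)%E.
  rewrite (bigD1 l)//= [in RHS](bigD1 l)//=.
  rewrite {1}/B2 eqxx {1}/B1 ltnn; congr (_ * _)%E.
  rewrite probability_setT mul1e; apply: eq_bigr => j jl.
  by rewrite /B2 (negbTE jl).
- by move=> _; rewrite /m1 /= /mrestr ltey_eq fin_num_measure//; exact: measurableI.
Qed.

End CoordinateFiltration.

(** * The self-normalized martingale *)

Section MeasurableMatrix.
Context {R : realType} {d : measure_display} {T : measurableType d}.

Definition mxmeas m n (X : T -> 'M[R]_(m, n)) :=
  forall i j, measurable_fun setT (fun w => X w i j).

Lemma mxmeas_cst m n (A : 'M[R]_(m, n)) : mxmeas (fun=> A).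
Proof. by move=> i j; exact: measurable_cst. Qed.

Lemma mxmeasD m n (X Y : T -> 'M[R]_(m, n)) :
  mxmeas X -> mxmeas Y -> mxmeas (fun w => X w + Y w).
Proof.
by move=> mX mY i j; under eq_fun do rewrite mxE; exact: measurable_funD.
Qed.

Lemma mxmeasZ m n (f : T -> R) (X : T -> 'M[R]_(m, n)) :
  measurable_fun setT f -> mxmeas X -> mxmeas (fun w => f w *: X w).
Proof.
by move=> mf mX i j; under eq_fun do rewrite mxE; exact: measurable_funM.
Qed.

Lemma mxmeas_tr m n (X : T -> 'M[R]_(m, n)) :
  mxmeas X -> mxmeas (fun w => (X w)^T).
Proof. by move=> mX i j; under eq_fun do rewrite mxE; exact: mX. Qed.

Lemma mxmeasM m n q (X : T -> 'M[R]_(m, n)) (Y : T -> 'M[R]_(n, q)) :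
  mxmeas X -> mxmeas Y -> mxmeas (fun w => X w *m Y w).
Proof.
move=> mX mY i j; under eq_fun do rewrite mxE.
by apply: measurable_sum => l; exact: measurable_funM.
Qed.

Lemma measurable_det n (X : T -> 'M[R]_n) :
  mxmeas X -> measurable_fun setT (fun w => \det (X w)).
Proof.
move=> mX; rewrite /determinant; apply: measurable_sum => s.
by apply: measurable_funM => //; apply: measurable_prod => i _; exact: mX.
Qed.

Lemma mxmeas_inv n (X : T -> 'M[R]_n) : (forall w, X w \in unitmx) ->
  mxmeas X -> mxmeas (fun w => invmx (X w)).
Proof.
move=> uX mX i j.
have -> : (fun w => invmx (X w) i j) =
    (fun w => (\det (X w))^-1 * cofactor (X w) j i).
  by apply/funext => w; rewrite /invmx uX !mxE.
apply: measurable_funM; first exact/measurable_fun_inv/measurable_det.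
rewrite /cofactor; apply: measurable_funM => //; apply: measurable_det => a b.
by under eq_fun do rewrite !mxE; exact: mX.
Qed.

(** The closed form of the mixture over [x] of law [N(0, 1)] of
    [exp (x^T S - x^T (V - 1) x / 2)]. *)
Definition selfnorm n (V : 'M[R]_n) (S : 'cV[R]_n) : R :=
  expR (qf (invmx V) S / 2 - ln (\det V) / 2).

Lemma measurable_qf n (V : T -> 'M[R]_n) (S : T -> 'cV[R]_n) :
  mxmeas V -> mxmeas S -> measurable_fun setT (fun w => qf (V w) (S w)).
Proof.
by move=> mV mS; apply: mxmeasM => //; apply: mxmeasM => //; exact: mxmeas_tr.
Qed.

Lemma measurable_selfnorm n (V : T -> 'M[R]_n) (S : T -> 'cV[R]_n) :
  (forall w, posdef (V w)) -> mxmeas V -> mxmeas S ->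
  measurable_fun setT (fun w => selfnorm (V w) (S w)).
Proof.
move=> pV mV mS; apply: measurableT_comp => //; apply: measurable_funB.
  apply: measurable_funM => //; apply: measurable_qf => //.
  by apply: mxmeas_inv => // w; exact: posdef_unit.
apply: measurable_funM => //; apply: (measurableT_comp (@measurable_ln R)).
exact: measurable_det.
Qed.

End MeasurableMatrix.

(** The quadratic form contributes the exponent of the tilt, and the determinant contributes its
    normalization [(1 + b)^(-1/2)]. *)
Lemma selfnorm_rank1 (R : realType) n (V : 'M[R]_n) (S k : 'cV[R]_n) (h : R) :
  posdef V -> selfnorm (V + k *m k^T) (S + h *: k) =
    selfnorm V S * tilt ((k^T *m invmx V *m S) 0 0) (qf (invmx V) k) h.
Proof.
move=> pV; have d0 := posdef_det_gt0 pV.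
have b1 : 0 < 1 + qf (invmx V) k by rewrite ltr_wpDr// qf_inv_ge0.
rewrite /selfnorm qf_inv_rank1// det_rank1// lnM ?posrE// /tilt -!expRD.
congr expR; field; by rewrite gt_eqF.
Qed.

Lemma sum_ord_ltS (R : nmodType) p (f : 'I_p -> R) l (lp : (l < p)%N) :
  \sum_(j < p | (j < l.+1)%N) f j = \sum_(j < p | (j < l)%N) f j + f (Ordinal lp).
Proof.
rewrite (bigD1 (Ordinal lp)) ?leqnn //= addrC; congr (_ + _).
by apply: eq_bigl => j; rewrite -val_eqE /= ltnS ltn_neqAle andbC.
Qed.

Section SelfNormalized.
Context {R : realType} {d : measure_display} {Omega : measurableType d}.
Variable P : probability Omega R.

Definition mxGmeas (G : set (set Omega)) m n (X : Omega -> 'M[R]_(m, n)) :=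
  forall i j, Gmeas G (fun w => X w i j).

Lemma mxGmeasP G m n (X : Omega -> 'M[R]_(m, n)) : sigma_algebra setT G ->
  mxGmeas G X <-> mxmeas (X : g_sigma_algebraType G -> _).
Proof.
by move=> sG; split => mX i j; have /(GmeasP _ sG) := mX i j.
Qed.

Lemma integral_selfnorm_step1 n G (h : Omega -> R) (V : Omega -> 'M[R]_n)
    (S k : Omega -> 'cV[R]_n) :
  sigma_algebra setT G -> G `<=` measurable ->
  measurable_fun setT h -> cond_gauss1 P G h ->
  mxGmeas G V -> mxGmeas G S -> mxGmeas G k -> (forall w, posdef (V w)) ->
  (\int[P]_w (selfnorm (V w + k w *m (k w)^T) (S w + h w *: k w))%:E =
   \int[P]_w (selfnorm (V w) (S w))%:E)%E.
Proof.
move=> sG Gm mh ch /(mxGmeasP _ sG) mV /(mxGmeasP _ sG) mS /(mxGmeasP _ sG) mk pV.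
under eq_integral do rewrite selfnorm_rank1//.
have miV : mxmeas (fun w : g_sigma_algebraType G => invmx (V w)).
  by apply: mxmeas_inv => // w; exact: posdef_unit.
apply: (integral_tilt_cond sG Gm mh ch).
- by apply/(GmeasP _ sG); exact: measurable_selfnorm.
- by apply/(GmeasP _ sG); do 2![apply: mxmeasM => //]; exact: mxmeas_tr.
- by apply/(GmeasP _ sG); exact: measurable_qf.
- by move=> w; exact: expR_ge0.
- by move=> w; exact: qf_inv_ge0.
Qed.

Lemma scaled_rank1 n (k : 'cV[R]_n) (c : R) :
  (c *: k) *m (c *: k)^T = c ^+ 2 *: (k *m k^T).
Proof. by rewrite linearZ/= -scalemxAl -scalemxAr scalerA. Qed.

Lemma posdefZ n (V : 'M[R]_n) (k : 'cV[R]_n) (c : R) : 0 <= c -> posdef V ->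
  posdef (V + c *: (k *m k^T)).
Proof.
move=> c0 pV; have := posdef_rank1 (Num.sqrt c *: k) pV.
by rewrite scaled_rank1 sqr_sqrtr.
Qed.

(** The vector is absorbed coordinate by coordinate: coordinate [l] is a scalar step along
    [z l *: k], which adds [z l ^ 2] times [k *m k^T]. As the squares sum to 1, the total is one
    full rank-one update, and no law of a linear combination has to be computed. *)
Lemma integral_selfnorm_step n p G (v : Omega -> 'rV[R]_p) (z : 'I_p -> R)
    (V : Omega -> 'M[R]_n) (S k : Omega -> 'cV[R]_n) :
  sigma_algebra setT G -> G `<=` measurable ->
  (forall j, measurable_fun setT (fun w => v w 0 j)) -> cond_std_gauss P G v ->
  mxGmeas G V -> mxGmeas G S -> mxGmeas G k -> (forall w, posdef (V w)) ->
  \sum_j z j ^+ 2 = 1 ->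
  (\int[P]_w (selfnorm (V w + k w *m (k w)^T)
     (S w + (\sum_j v w 0 j * z j) *: k w))%:E =
   \int[P]_w (selfnorm (V w) (S w))%:E)%E.
Proof.
move=> sG Gm mv cv mV mS mk pV z1.
pose c l := \sum_(j < p | (j < l)%N) z j ^+ 2.
pose e l w := \sum_(j < p | (j < l)%N) v w 0 j * z j.
have c0 l : 0 <= c l by apply: sumr_ge0 => j _; exact: sqr_ge0.
have H l : (l <= p)%N ->
  (\int[P]_w (selfnorm (V w + c l *: (k w *m (k w)^T)) (S w + e l w *: k w))%:E =
   \int[P]_w (selfnorm (V w) (S w))%:E)%E.
  elim: l => [_|l IH lp].
    apply: eq_integral => w _; rewrite /c /e !big_pred0//.
    by rewrite !scale0r !addr0.
  pose lo := Ordinal lp.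
  have pV' w : posdef (V w + c l *: (k w *m (k w)^T)) by exact: posdefZ.
  pose G' := coord_sigma G v l.
  have sG' : sigma_algebra setT G' by exact: coord_sigma_algebra.
  have lift m q (X : Omega -> 'M[R]_(m, q)) : mxGmeas G X ->
      mxmeas (X : g_sigma_algebraType G' -> _).
    by move=> mX; apply/(mxGmeasP _ sG') => i j; exact: Gmeas_coord_sigma.
  have mV' : mxGmeas G' (fun w => V w + c l *: (k w *m (k w)^T)).
    apply/(mxGmeasP _ sG'); apply: mxmeasD; first exact: lift.
    apply: mxmeasZ; first exact: measurable_cst.
    apply: mxmeasM; first exact: lift.
    by apply: mxmeas_tr; exact: lift.
  have mS' : mxGmeas G' (fun w => S w + e l w *: k w).
    apply/(mxGmeasP _ sG'); apply: mxmeasD; first exact: lift.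
    apply: mxmeasZ; last exact: lift.
    rewrite /e; under eq_fun do rewrite big_mkcond/=.
    apply: measurable_sum => j; case: (boolP (j < l)%N) => [jl|_]; last exact: measurable_cst.
    apply: measurable_funM; last exact: measurable_cst.
    by apply/(GmeasP _ sG'); exact: coord_sigma_coord.
  have mk' : mxGmeas G' (fun w => z lo *: k w).
    by apply/(mxGmeasP _ sG'); apply: mxmeasZ; [exact: measurable_cst|exact: lift].
  have E := integral_selfnorm_step1 sG' (coord_sigma_measurable Gm mv (l := l))
    (mv lo) (cond_gauss_coord sG Gm mv (l := lo) cv) mV' mS' mk' pV'.
  apply: eq_trans (eq_trans E (IH (ltnW lp))).
  apply: eq_integral => w _.
  have -> : e l.+1 w = e l w + v w 0 lo * z lo by exact: sum_ord_ltS.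
  have -> : c l.+1 = c l + z lo ^+ 2 by exact: sum_ord_ltS.
  by rewrite scaled_rank1 scalerA !scalerDl !addrA.
have full (f : 'I_p -> R) : \sum_(j < p | (j < p)%N) f j = \sum_j f j.
  by apply: eq_bigl => j; rewrite ltn_ord.
apply: eq_trans (H p (leqnn p)); apply: eq_integral => w _.
by rewrite /c /e !full z1 scale1r.
Qed.

(** Induction on [M]: the sums below [M] are [G M]-measurable, so the vector step applies to
    observation [M], and the empty sums give the value 1. *)
Lemma integral_selfnorm n p (G : nat -> set (set Omega))
    (v : nat -> Omega -> 'rV[R]_p) (k : nat -> Omega -> 'cV[R]_n) (z : 'I_p -> R) :
  (forall i, sigma_algebra setT (G i)) -> (forall i, G i `<=` measurable) ->
  (forall i, G i `<=` G i.+1) -> (forall i, cond_std_gauss P (G i) (v i)) ->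
  (forall i j, Gmeas (G i.+1) (fun w => v i w 0 j)) ->
  (forall i, mxGmeas (G i) (k i)) -> \sum_j z j ^+ 2 = 1 ->
  forall M, (\int[P]_w (selfnorm (1%:M + \sum_(i < M) k i w *m (k i w)^T)
    (\sum_(i < M) (\sum_j v i w 0 j * z j) *: k i w))%:E = 1)%E.
Proof.
move=> sG Gm GS cv mv mk z1 M.
pose V M w := 1%:M + \sum_(i < M) k i w *m (k i w)^T.
pose S M w := \sum_(i < M) (\sum_j v i w 0 j * z j) *: k i w.
have pV m w : posdef (V m w).
  elim: m => [|m IH]; rewrite /V ?big_ord0 ?addr0; first exact: posdef1.
  by rewrite big_ord_recr/= addrA; exact: posdef_rank1.
have up m q i (X : Omega -> 'M[R]_(m, q)) : mxGmeas (G i) X -> mxGmeas (G i.+1) X.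
  by move=> mX a b B mB; apply: GS; exact: mX.
have mV m : mxGmeas (G m) (V m).
  elim: m => [|m IH].
    apply/(mxGmeasP _ (sG 0%N)) => i j; rewrite /V.
    by under eq_fun do rewrite big_ord0; exact: measurable_cst.
  have -> : V m.+1 = (fun w => V m w + k m w *m (k m w)^T).
    by apply/funext => w; rewrite /V big_ord_recr/= addrA.
  have mk1 : mxmeas (k m : g_sigma_algebraType (G m.+1) -> _).
    by apply/(mxGmeasP _ (sG _)); exact: up.
  apply/(mxGmeasP _ (sG _)); apply: mxmeasD; first by apply/(mxGmeasP _ (sG _)); exact: up.
  by apply: mxmeasM => //; exact: mxmeas_tr.
have mS m : mxGmeas (G m) (S m).
  elim: m => [|m IH].
    apply/(mxGmeasP _ (sG 0%N)) => i j; rewrite /S.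
    by under eq_fun do rewrite big_ord0; exact: measurable_cst.
  have -> : S m.+1 = (fun w => S m w + (\sum_j v m w 0 j * z j) *: k m w).
    by apply/funext => w; rewrite /S big_ord_recr.
  have mk1 : mxmeas (k m : g_sigma_algebraType (G m.+1) -> _).
    by apply/(mxGmeasP _ (sG _)); exact: up.
  apply/(mxGmeasP _ (sG _)); apply: mxmeasD; first by apply/(mxGmeasP _ (sG _)); exact: up.
  apply: mxmeasZ => //; apply: measurable_sum => j; apply: measurable_funM => //.
  by apply/(GmeasP _ (sG _)); exact: mv.
elim: M => [|M IH].
  under eq_integral do rewrite !big_ord0 addr0 /selfnorm det1 ln1 /qf mulmx0 mxE !mul0r subrr expR0.
  by rewrite integral_cst// mul1e; exact: probability_setT.
have mvT j : measurable_fun setT (fun w => v M w 0 j).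
  by apply: (Gmeas_measurable (Gm M.+1)); exact: mv.
have E := integral_selfnorm_step (sG M) (Gm M) mvT (cv M) (mV M) (mS M) (mk M) (pV M) z1.
apply: eq_trans (eq_trans E IH).
by apply: eq_integral => w _; rewrite /V /S !big_ord_recr/= addrA.
Qed.

End SelfNormalized.

(** * A weighted net of the sphere *)

Section SphereNet.
Variable R : realType.

Lemma qfZ n (A : 'M[R]_n) (c : R) x : qf A (c *: x) = c ^+ 2 * qf A x.
Proof.
have TZ : (c *: x)^T = c *: x^T by rewrite linearZ.
by rewrite /qf TZ -!scalemxAl -scalemxAr scalerA mxE expr2.
Qed.

Lemma qf_segment n (A : 'M[R]_n) (t : R) (x y : 'cV[R]_n) :
  qf A ((1 - t) *: x + t *: y) =
    (1 - t) * qf A x + t * qf A y - t * (1 - t) * qf A (x - y).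
Proof.
have TD (u w : 'cV[R]_n) : (u + w)^T = u^T + w^T by rewrite linearD.
have TZ c (u : 'cV[R]_n) : (c *: u)^T = c *: u^T by rewrite linearZ.
rewrite /qf -(scaleN1r y) !TD !TZ !mulmxDl !mulmxDr.
rewrite -!scalemxAl -!scalemxAr !mxE; ring.
Qed.

Lemma qf_segment_max n (A : 'M[R]_n) (t : R) (x y : 'cV[R]_n) :
  psd A -> 0 <= t <= 1 ->
  qf A ((1 - t) *: x + t *: y) <= qf A x \/ qf A ((1 - t) *: x + t *: y) <= qf A y.
Proof.
move=> pA /andP[t0 t1]; rewrite qf_segment.
have : 0 <= t * (1 - t) * qf A (x - y).
  by rewrite mulr_ge0 ?mulr_ge0 ?subr_ge0//; exact: pA.
move: (t * _ * _) => r r0.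
by have [xy|/ltW yx] := leP (qf A x) (qf A y); [right|left]; nra.
Qed.

(* By convexity the coordinates can be moved to an endpoint one at a time. *)
Lemma qf_box_vertex n (A : 'M[R]_n) (y : 'cV[R]_n) (t a b : 'I_n -> R) :
  psd A -> (forall j, 0 <= t j <= 1) ->
  (forall j, y j 0 = (1 - t j) * a j + t j * b j) ->
  exists2 y' : 'cV[R]_n, forall j, y' j 0 = a j \/ y' j 0 = b j & qf A y <= qf A y'.
Proof.
move=> pA t01 yE.
suff H l : (l <= n)%N -> exists y' : 'cV[R]_n,
    [/\ forall j : 'I_n, (j < l)%N -> y' j 0 = a j \/ y' j 0 = b j,
        forall j : 'I_n, (l <= j)%N -> y' j 0 = y j 0 & qf A y <= qf A y'].
  by have [y' [h _ ?]] := H n (leqnn n); exists y' => // j; exact: h.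
elim: l => [_|l IH ln]; first by exists y.
have [y' [h1 h2 h3]] := IH (ltnW ln); pose lo := Ordinal ln.
pose u c : 'cV[R]_n := \col_j if j == lo then c else y' j 0.
have uE c : forall j : 'I_n, (j < l)%N -> u c j 0 = y' j 0.
  move=> j jl; rewrite mxE ifF//; apply/negbTE.
  by rewrite -val_eqE /= neq_ltn jl.
have uE' c : forall j : 'I_n, (l < j)%N -> u c j 0 = y' j 0.
  move=> j jl; rewrite mxE ifF//; apply/negbTE.
  by rewrite -val_eqE /= neq_ltn jl orbT.
have y'E : y' = (1 - t lo) *: u (a lo) + t lo *: u (b lo).
  apply/matrixP => j i; rewrite (ord1 i) !mxE; case: eqP => [->|_].
    by rewrite h2// yE.
  by rewrite -mulrDl subrK mul1r.
have G c : c = a lo \/ c = b lo -> qf A y' <= qf A (u c) -> exists y' : 'cV[R]_n,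
    [/\ forall j : 'I_n, (j < l.+1)%N -> y' j 0 = a j \/ y' j 0 = b j,
        forall j : 'I_n, (l < j)%N -> y' j 0 = y j 0 & qf A y <= qf A y'].
  move=> cab le; exists (u c); split.
  - move=> j; rewrite ltnS leq_eqVlt => /orP[/eqP jl|jl].
      have -> : j = lo by exact: val_inj.
      by rewrite mxE eqxx.
    by rewrite uE//; exact: h1.
  - by move=> j lj; rewrite uE'// h2// ltnW.
  - exact: le_trans le.
have [] := qf_segment_max (u (a lo)) (u (b lo)) pA (t01 lo); rewrite -y'E.
- by apply: G; left.
- by apply: G; right.
Qed.

(** Keeps the total weight of the net at most 1: for each of the two signs the geometric series
    stays below 1/2. *)
Lemma sum_sign_geom B :
  \sum_(x : bool * 'I_B) (2^-1 : R) ^+ (x.2 + 2) <= 1.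
Proof.
rewrite -(pair_bigA _ (fun (b : bool) (n : 'I_B) => (2^-1 : R) ^+ (n + 2))) /=.
have E : \sum_(n < B) (2^-1 : R) ^+ (n + 2) = 2^-1 - 2^-1 ^+ B.+1.
  elim: B => [|B IH]; first by rewrite big_ord0 expr1 subrr.
  by rewrite big_ord_recr/= IH addn2 !exprS; field.
rewrite big_bool /= E; have : 0 <= (2^-1 : R) ^+ B.+1 by rewrite exprn_ge0// invr_ge0.
lra.
Qed.

(** The net consists of normalized integer vectors. After scaling [x] to squared norm [p], its
    coordinates can be rounded to neighbouring integers without decreasing the form, and the result
    has squared norm at most [4 p]. Weights [2^-(n + 2)] per coordinate, instead of a count of
    points, make the cost linear in [p] with no logarithm. *)
Lemma sphere_net p : (0 < p)%N ->
  exists (I : finType) (z : I -> 'cV[R]_p) (c : I -> R),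
  [/\ forall i, \sum_j z i j 0 ^+ 2 = 1, forall i, 0 <= c i, \sum_i c i <= 1 &
    forall (A : 'M[R]_p) (x : 'cV[R]_p), psd A -> \sum_j x j 0 ^+ 2 = 1 ->
      exists2 i, qf A x <= 4 * qf A (z i) & expR (- (12 * p.-1%:R)) <= c i].
Proof.
(* In dimension one [x] is a sign, so a single direction of weight 1 suffices and the cost is
   exactly 0. *)
case: p => // p _; have [p0|p0] := eqVneq p 0%N.
  rewrite {}p0; exists unit, (fun=> const_mx 1), (fun=> 1); split => //.
  - by move=> _; rewrite big_ord1 mxE expr1n.
  - by rewrite big_const card_unit /= addr0.
  - move=> A x pA; rewrite big_ord1 => x1; exists tt; last first.
      by rewrite mulr0 oppr0 expR0.
    have -> : x = x 0 0 *: const_mx 1.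
      by apply/matrixP => i j; rewrite !ord1 !mxE mulr1.
    rewrite qfZ x1 mul1r; have := pA (const_mx 1); rewrite -/(qf _ _).
    by move: (qf _ _) => r; lra.
(* There are [q.+2] values because the integer part of [sqrt q * |x_j|] is at most [q] and rounding
   up adds one. *)
pose q := p.+1; pose I := {ffun 'I_q -> bool * 'I_q.+2}.
pose y (i : I) : 'cV[R]_q := \col_j ((-1) ^+ (i j).1 * (i j).2%:R).
pose e0 : 'cV[R]_q := delta_mx 0 0.
pose nrm (i : I) := \sum_j y i j 0 ^+ 2.
pose z (i : I) := if nrm i == 0 then e0 else (Num.sqrt (nrm i))^-1 *: y i.
pose c (i : I) : R := \prod_j 2^-1 ^+ ((i j).2 + 2).
have nrm0 i : 0 <= nrm i by apply: sumr_ge0 => j _; exact: sqr_ge0.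
exists I, z, c; split.
- move=> i; rewrite /z; case: eqVneq => [_|n0].
    rewrite (bigD1 ord0)//= big1 => [|j /negbTE j0]; first by rewrite mxE eqxx expr1n addr0.
    by rewrite mxE j0 expr0n.
  under eq_bigr do rewrite mxE exprMn exprVn sqr_sqrtr//.
  by rewrite -mulr_sumr mulVf.
- by move=> i; apply: prodr_ge0 => j _; rewrite exprn_ge0// invr_ge0.
- rewrite /c -(bigA_distr_bigA (fun (j : 'I_q) (x : bool * 'I_q.+2) => (2^-1 : R) ^+ (x.2 + 2))) /=.
  apply: prodr_ile1 => j _; rewrite sum_sign_geom andbT.
  by apply: sumr_ge0 => x _; rewrite exprn_ge0// invr_ge0.
move=> A x pA x1.
pose s := Num.sqrt (q%:R : R).
have s2 : s ^+ 2 = q%:R by rewrite sqr_sqrtr.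
have s0 : 0 <= s by exact: sqrtr_ge0.
pose n j := Num.truncn (s * `|x j 0|).
pose sg j : R := (-1) ^+ (x j 0 < 0)%R.
have xj1 j : `|x j 0| <= 1.
  rewrite -(@ler_sqr _ `|x j 0| 1) ?nnegrE// expr1n real_normK ?num_real//.
  by rewrite -x1 (bigD1 j)//= lerDl sumr_ge0// => i _; exact: sqr_ge0.
have sq : s <= q%:R.
  rewrite -(@ler_sqr _ s) ?nnegrE ?ler0n// s2 expr2 -natrM ler_nat leq_pmulr//.
have nP j : (n j)%:R <= s * `|x j 0| < (n j).+1%:R.
  by apply: truncn_itv; rewrite mulr_ge0.
have nq j : (n j <= q)%N.
  rewrite -(@ler_nat R); have /andP[h _] := nP j; apply: (le_trans h).
  by apply: le_trans sq; rewrite ler_piMr.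
pose t j := s * `|x j 0| - (n j)%:R.
have t01 j : 0 <= t j <= 1.
  have /andP[h1 h2] := nP j; rewrite subr_ge0 h1 /t lerBlDr /=.
  by rewrite addrC natr1 ltW.
have yE j : (s *: x) j 0 = (1 - t j) * (sg j * (n j)%:R) + t j * (sg j * (n j).+1%:R).
  rewrite mxE {1}(realEsign (num_real (x j 0))) -/(sg j) -natr1 /t; ring.
have [y' y'v le] := qf_box_vertex pA t01 yE.
pose m j : nat := if y' j 0 == sg j * (n j)%:R then n j else (n j).+1.
have y'E j : y' j 0 = sg j * (m j)%:R.
  by rewrite /m; case: eqP => // /eqP ne; case: (y'v j) => // e; rewrite e eqxx in ne.
have mq j : (m j < q.+2)%N.
  by rewrite /m; case: ifP => _; rewrite ltnS ?ltnS ?nq// ltnW// ltnS nq.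
pose i : I := [ffun j => (x j 0 < 0, Ordinal (mq j))].
have yi : y i = y' by apply/matrixP => j k; rewrite (ord1 k) mxE ffunE y'E.
(* Rounding up at most gives [(r + 1)^2 <= 2 r^2 + 2] with [r = sqrt q * |x_j|]; summed over [j]
   this is [2 q + 2 q]. *)
have m2 j : (m j)%:R ^+ 2 <= 2 * (q%:R * x j 0 ^+ 2) + 2.
  have : (m j)%:R <= s * `|x j 0| + 1.
    have /andP[h1 h2] := nP j; rewrite /m; case: ifP => _; last first.
      by rewrite -natr1 lerD2r.
    by rewrite (le_trans h1)// lerDl.
  have m0 : 0 <= (m j)%:R :> R by [].
  have -> : q%:R * x j 0 ^+ 2 = (s * `|x j 0|) ^+ 2.
    by rewrite exprMn s2 real_normK ?num_real.
  move: (s * _) m0 => r m0 mr; apply: (@le_trans _ _ ((r + 1) ^+ 2)).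
    by apply: lerXn2r; rewrite ?nnegrE// (le_trans m0).
  by have := sqr_ge0 (r - 1); rewrite !expr2; lra.
have nrm4 : \sum_j (m j)%:R ^+ 2 <= 4 * q%:R :> R.
  apply: le_trans (ler_sum _ (fun j _ => m2 j)) _.
  rewrite big_split/= -!mulr_sumr x1 sumr_const card_ord.
  by rewrite -[X in _ + X]mulr_natr mulr1 -/q; move: (q%:R) => r; lra.
have nrmE : nrm i = \sum_j (m j)%:R ^+ 2.
  apply: eq_bigr => j _; rewrite yi y'E exprMn /sg -exprM mulnC exprM sqrrN !expr1n mul1r//.
exists i.
- have q0 : 0 < q%:R :> R by rewrite ltr0n.
  have le' : q%:R * qf A x <= qf A y' by rewrite -s2 -qfZ.
  have z0 : 0 <= qf A (z i) by exact: pA.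
  have y'z : qf A y' <= nrm i * qf A (z i).
    rewrite /z; case: eqVneq => [n0|n0].
      have -> : y' = 0.
        apply/matrixP => j k; rewrite (ord1 k) [RHS]mxE -yi.
        move/eqP: n0; rewrite psumr_eq0 => [|? _]; last exact: sqr_ge0.
        by move=> /allP /(_ j); rewrite mem_index_enum sqrf_eq0 => /(_ isT)/eqP.
      by rewrite /qf mulmx0 mxE n0 mul0r.
    by rewrite qfZ exprVn sqr_sqrtr// mulrA mulfV// mul1r yi.
  rewrite -(ler_pM2l q0) (le_trans le')// (le_trans y'z)//.
  by rewrite mulrA ler_wpM2r// nrmE mulrC.
- have -> : c i = 2^-1 ^+ (\sum_j (m j + 2)).
    by rewrite -prodrXr; apply: eq_bigr => j _; rewrite ffunE.
  (* [m <= m^2] on naturals turns the norm bound into a sum of at most [4 q], and the shift by 2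
     adds [2 q]. *)
  have sum6 : (\sum_j (m j + 2) <= 6 * q)%N.
    rewrite big_split/= sum_nat_const card_ord.
    have : (\sum_j m j <= 4 * q)%N.
      rewrite -(@ler_nat R) natr_sum natrM (le_trans _ nrm4)//.
      apply: ler_sum => j _; rewrite -natrX ler_nat.
      by case: (m j) => // r; rewrite -mulnn leq_pmull.
    move=> h; apply: leq_trans (leq_add h (leqnn _)) _.
    by rewrite -/q [(q * 2)%N]mulnC -mulnDl.
  apply: (@le_trans _ _ (2^-1 ^+ (6 * q))); last first.
    by apply: ler_wiXn2l => //; rewrite ?invr_ge0// invf_le1// ler1n.
  (* [1 / e <= 1 / 2], and [6 (p + 1) <= 12 p] because [p >= 1] here. *)
  apply: (@le_trans _ _ (expR (-1) ^+ (6 * q))); last first.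
    apply: lerXn2r; rewrite ?nnegrE ?expR_ge0 ?invr_ge0//.
    rewrite expRN lef_pV2 ?posrE ?expR_gt0//.
    by have := expR_ge1Dx (1 : R); rewrite -natr1 addrC.
  rewrite -expRM_natl ler_expR mulrN1 lerN2 /= natrM -[q]addn1 natrD.
  have : 1 <= p%:R :> R by rewrite ler1n lt0n.
  by move: (p%:R) => r; lra.
Qed.

End SphereNet.

(** * Ridge regression *)

Section Ridge.
Variable R : realType.

(** This discriminant bound serves two Cauchy-Schwarz inequalities, the Euclidean one and the one
    pairing [V] with its inverse. *)
Lemma sqr_le_of_discr (A B C : R) : 0 <= A -> 0 <= B ->
  (forall t, 0 <= A - 2 * t * C + t ^+ 2 * B) -> C ^+ 2 <= A * B.
Proof.
move=> A0 B0 h; have [B1|B1] := eqVneq B 0.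
  have [C0|C0] := eqVneq C 0; first by rewrite C0 B1 expr0n mulr0.
  (* With [B = 0] the polynomial is affine, and this [t] brings it down to -1. *)
  have := h ((A + 1) / (2 * C)); rewrite B1 mulr0 addr0.
  have -> : A - 2 * ((A + 1) / (2 * C)) * C = - 1 by field.
  by rewrite lerNr oppr0 ler10.
have {}B0 : 0 < B by rewrite lt_neqAle eq_sym B1.
have := h (C / B); have -> : A - 2 * (C / B) * C + (C / B) ^+ 2 * B = A - C ^+ 2 / B.
  by field.
by rewrite subr_ge0 ler_pdivrMr.
Qed.

Lemma cauchy_schwarz_sum (I : finType) (a b : I -> R) :
  (\sum_i a i * b i) ^+ 2 <= (\sum_i a i ^+ 2) * (\sum_i b i ^+ 2).
Proof.
apply: sqr_le_of_discr; [by apply: sumr_ge0 => i _; exact: sqr_ge0..|] => t.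
rewrite !mulr_sumr -sumrB -big_split/=; apply: sumr_ge0 => i _.
by have -> : a i ^+ 2 - 2 * t * (a i * b i) + t ^+ 2 * b i ^+ 2 = (a i - t * b i) ^+ 2;
  [ring|exact: sqr_ge0].
Qed.

Lemma vnorm_ge0 n (x : 'cV[R]_n) : 0 <= vnorm x.
Proof. exact: sqrtr_ge0. Qed.

Lemma vnorm_sqr n (x : 'cV[R]_n) : vnorm x ^+ 2 = \sum_i x i 0 ^+ 2.
Proof. by rewrite sqr_sqrtr// sumr_ge0// => i _; exact: sqr_ge0. Qed.

Lemma vnorm_sqrE n (x : 'cV[R]_n) : vnorm x ^+ 2 = (x^T *m x) 0 0.
Proof.
by rewrite vnorm_sqr mxE; apply: eq_bigr => i _; rewrite mxE expr2.
Qed.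

Lemma vnormZ n (c : R) (x : 'cV[R]_n) : vnorm (c *: x) = `|c| * vnorm x.
Proof.
rewrite /vnorm -sqrtr_sqr -sqrtrM ?sqr_ge0// mulr_sumr.
by congr Num.sqrt; apply: eq_bigr => i _; rewrite mxE exprMn.
Qed.

Lemma vnorm_eq0 n (x : 'cV[R]_n) : vnorm x = 0 -> x = 0.
Proof.
move=> /(congr1 (fun r => r ^+ 2)); rewrite vnorm_sqr expr0n /= => /eqP.
rewrite psumr_eq0 => [/allP h|i _]; last exact: sqr_ge0.
apply/matrixP => i j; rewrite (ord1 j) [RHS]mxE.
by have := h i; rewrite mem_index_enum sqrf_eq0 => /(_ isT)/eqP.
Qed.

Lemma dot_le n (x y : 'cV[R]_n) : (x^T *m y) 0 0 <= vnorm x * vnorm y.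
Proof.
rewrite (le_trans (ler_norm _))// -(@ler_sqr _ `|_|) ?nnegrE ?mulr_ge0 ?vnorm_ge0//.
rewrite real_normK ?num_real// exprMn !vnorm_sqr mxE.
rewrite (eq_bigr (fun i => x i 0 * y i 0)) => [|i _]; last by rewrite mxE.
exact: cauchy_schwarz_sum.
Qed.

(** Bounds the set whose supremum defines [opnorm], so that the supremum is an upper bound. *)
Lemma vnorm_mul_le_frob m n (A : 'M[R]_(m, n)) x :
  vnorm (A *m x) <= Num.sqrt (frob2 A) * vnorm x.
Proof.
rewrite /vnorm -sqrtrM; last first.
  by apply: sumr_ge0 => i _; apply: sumr_ge0 => j _; exact: sqr_ge0.
apply: ler_wsqrtr; rewrite /frob2 mulr_suml; apply: ler_sum => i _.
by rewrite mxE; exact: cauchy_schwarz_sum.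
Qed.

Lemma vnorm_mul_le_opnorm m n (A : 'M[R]_(m, n)) x :
  vnorm (A *m x) <= opnorm A * vnorm x.
Proof.
have [x0|x0] := eqVneq (vnorm x) 0.
  rewrite x0 mulr0 (vnorm_eq0 x0) mulmx0 /vnorm.
  by rewrite big1 ?sqrtr0// => i _; rewrite mxE expr0n.
have xp : 0 < vnorm x by rewrite lt_neqAle eq_sym x0 vnorm_ge0.
rewrite -ler_pdivrMr// mulrC.
have -> : (vnorm x)^-1 * vnorm (A *m x) = vnorm (A *m ((vnorm x)^-1 *: x)).
  by rewrite -scalemxAr vnormZ ger0_norm// invr_ge0 ltW.
apply: ub_le_sup.
  exists (Num.sqrt (frob2 A)) => _ [y /= y1 <-].
  by rewrite -[leRHS]mulr1 -y1; exact: vnorm_mul_le_frob.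
exists ((vnorm x)^-1 *: x) => //=.
by rewrite vnormZ ger0_norm ?mulVf// invr_ge0 ltW.
Qed.

Lemma opnorm_ge0 m n (A : 'M[R]_(m, n)) : 0 <= opnorm A.
Proof.
case: n A => [A|n A].
  (* Without columns there is no unit vector, and the supremum of the empty set is 0 by
     convention. *)
  rewrite /opnorm [X in sup X](_ : _ = set0) ?sup0//.
  apply/seteqP; split => // _ [x /= + _]; rewrite /vnorm big_ord0 sqrtr0 => /esym/eqP.
  by rewrite oner_eq0.
have := vnorm_mul_le_opnorm A (delta_mx 0 0).
have -> : vnorm (delta_mx 0 0 : 'cV[R]_n.+1) = 1.
  rewrite /vnorm (bigD1 ord0)//= big1 => [|j /negbTE j0].
    by rewrite mxE eqxx expr1n addr0 sqrtr1.
  by rewrite mxE j0 expr0n.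
by rewrite mulr1; exact: le_trans (vnorm_ge0 _).
Qed.

(** With [h = A^T x], duality gives [|h|^2 = x^T A h], at most [|x| |A h|]; one factor [|h|] then
    cancels. *)
Lemma vnorm_trmx_mul_le m n (A : 'M[R]_(m, n)) (x : 'cV[R]_m) :
  vnorm (A^T *m x) <= opnorm A * vnorm x.
Proof.
set h := A^T *m x; have [h0|h0] := eqVneq (vnorm h) 0.
  by rewrite h0 mulr_ge0 ?opnorm_ge0 ?vnorm_ge0.
have hp : 0 < vnorm h by rewrite lt_neqAle eq_sym h0 vnorm_ge0.
rewrite -(ler_pM2r hp) -expr2 vnorm_sqrE {1}/h trmx_mul trmxK -mulmxA.
rewrite (le_trans (dot_le _ _))// mulrAC mulrC ler_wpM2r ?vnorm_ge0//.
exact: vnorm_mul_le_opnorm.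
Qed.

Lemma opnorm_le m n (A : 'M[R]_(m, n)) (c : R) : (0 < n)%N ->
  (forall x : 'cV[R]_n, vnorm x = 1 -> vnorm (A *m x) <= c) -> opnorm A <= c.
Proof.
case: n A => // n A _ h; apply: ge_sup; last by move=> _ [x /= x1 <-]; exact: h.
exists (vnorm (A *m delta_mx 0 0)), (delta_mx 0 0) => //=.
rewrite /vnorm (bigD1 ord0)//= big1 => [|j /negbTE j0].
  by rewrite mxE eqxx expr1n addr0 sqrtr1.
by rewrite mxE j0 expr0n.
Qed.

Lemma frob2_tr m n (A : 'M[R]_(m, n)) : frob2 A = \tr (A^T *m A).
Proof.
rewrite /frob2 exchange_big /=; apply: eq_bigr => j _; rewrite mxE.
by apply: eq_bigr => i _; rewrite mxE expr2.
Qed.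

Lemma frob2_trmx m n (A : 'M[R]_(m, n)) : frob2 A^T = frob2 A.
Proof.
rewrite /frob2 exchange_big; apply: eq_bigr => i _; apply: eq_bigr => j _.
by rewrite mxE.
Qed.

Lemma frob2_ge0 m n (A : 'M[R]_(m, n)) : 0 <= frob2 A.
Proof. by apply: sumr_ge0 => i _; apply: sumr_ge0 => j _; exact: sqr_ge0. Qed.

Lemma frob2_eq0 m n (A : 'M[R]_(m, n)) : frob2 A = 0 -> A = 0.
Proof.
move=> /eqP; rewrite psumr_eq0 => [/allP h|i _]; last first.
  by apply: sumr_ge0 => j _; exact: sqr_ge0.
apply/matrixP => i j; rewrite [RHS]mxE.
have := h i; rewrite mem_index_enum => /(_ isT).
rewrite psumr_eq0 => [/allP h'|? _]; last exact: sqr_ge0.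
by have := h' j; rewrite mem_index_enum sqrf_eq0 => /(_ isT)/eqP.
Qed.

Lemma frob2_sub m n (A B : 'M[R]_(m, n)) (t : R) :
  frob2 (A - t *: B) = frob2 A - 2 * t * \tr (A^T *m B) + t ^+ 2 * frob2 B.
Proof.
rewrite !frob2_tr; have TB : (A - t *: B)^T = A^T - t *: B^T by rewrite linearB/= linearZ.
rewrite TB mulmxBl !mulmxBr -!scalemxAl -!scalemxAr.
have trB (X Y : 'M[R]_n) : \tr (X - Y) = \tr X - \tr Y by rewrite raddfB.
rewrite !trB !mxtraceZ.
have -> : \tr (B^T *m A) = \tr (A^T *m B) by rewrite -mxtrace_tr trmx_mul trmxK.
ring.
Qed.

(** The first-order condition: [D] is half the gradient in [phi^T], and along [- D^T] the objective
    is a quadratic in [t] with slope [-2 |D|^2] at 0, contradicting minimality unless [D = 0]. *)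
Lemma ridge_normal_eq M L m (K : 'M[R]_(M, L)) (A : 'M[R]_(M, m)) mu phi :
  is_ridge K A mu phi -> K^T *m K *m phi^T + mu ^+ 2 *: phi^T = K^T *m A.
Proof.
move=> h; pose X := K *m phi^T - A; pose D := K^T *m X + mu ^+ 2 *: phi^T.
suff D0 : D = 0.
  apply/eqP; rewrite -subr_eq0; apply/eqP.
  by rewrite addrAC -mulmxA -mulmxBr; exact: D0.
apply: frob2_eq0; pose E := frob2 (K *m D) + mu ^+ 2 * frob2 D.
have E0 : 0 <= E.
  by apply: addr_ge0; [|apply: mulr_ge0]; [exact: frob2_ge0|exact: sqr_ge0|exact: frob2_ge0].
have obj t : ridge_obj K A mu (phi - t *: D^T) =
    ridge_obj K A mu phi - 2 * t * frob2 D + t ^+ 2 * E.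
  rewrite /ridge_obj.
  have -> : K *m (phi - t *: D^T)^T - A = X - t *: (K *m D).
    rewrite linearB/= linearZ/= trmxK mulmxBr -scalemxAr /X.
    by rewrite addrAC.
  rewrite !frob2_sub frob2_trmx -/X.
  have FD : frob2 D = \tr (X^T *m (K *m D)) + mu ^+ 2 * \tr (phi^T *m D^T).
    have DT : D^T = X^T *m K + mu ^+ 2 *: phi.
      by rewrite /D [(_ + _)^T]linearD/= trmx_mul trmxK [(_ *: _)^T]linearZ/= trmxK.
    rewrite frob2_tr {1}DT mulmxDl raddfD/= -scalemxAl linearZ/= mulmxA; congr (_ + _ * _).
    by rewrite -[RHS]mxtrace_tr trmx_mul !trmxK mxtrace_mulC.
  rewrite /E FD; ring.
have := frob2_ge0 D; rewrite le_eqVlt => /predU1P[->//|D0].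
(* This step length keeps [t E] at most [|D|^2], so the linear decrease wins; the [+ 1] avoids a
   zero denominator. *)
have t0 : 0 < frob2 D / (E + 1) by rewrite divr_gt0// ltr_wpDl.
have := h (phi - (frob2 D / (E + 1)) *: D^T); rewrite obj.
move: t0; set t := _ / _ => t0; rewrite -addrA lerDl.
have -> : - (2 * t * frob2 D) + t ^+ 2 * E = - (t * (2 * frob2 D - t * E)) by ring.
rewrite oppr_ge0 pmulr_rle0// subr_le0 => h1; exfalso.
have : t * E <= frob2 D.
  rewrite /t mulrAC ler_pdivrMr ?ltr_wpDl// ler_pM2l//; lra.
lra.
Qed.

Section Energy.
Variables (L M : nat) (K : 'M[R]_(M, L)) (y : 'cV[R]_L) (r : 'cV[R]_M).
Let V := 1%:M + K^T *m K.
Hypothesis Vy : V *m y = K^T *m r.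

Lemma ridge_energyE : qf V y = vnorm y ^+ 2 + vnorm (K *m y) ^+ 2.
Proof.
rewrite !vnorm_sqrE /qf /V mulmxDr mulmx1 mulmxDl mxE; congr (_ + _).
by rewrite trmx_mul !mulmxA.
Qed.

Lemma ridge_energy_dot : qf V y = (y^T *m (K^T *m r)) 0 0.
Proof. by rewrite /qf -mulmxA Vy. Qed.

(** The energy equals the inner product of [K y] and [r], hence is at most [|K y| |r|], and it also
    dominates [|K y|^2]. *)
Lemma ridge_energy_le_norm : qf V y <= vnorm r ^+ 2.
Proof.
have E := ridge_energy_dot; have E' := ridge_energyE.
have : qf V y <= vnorm (K *m y) * vnorm r.
  by rewrite E mulmxA -trmx_mul; exact: dot_le.
have := vnorm_ge0 r; have := vnorm_ge0 (K *m y); have := sqr_ge0 (vnorm y).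
rewrite E' => *; nra.
Qed.

(** The quadratic for the discriminant bound is the energy of [y - t V^-1 b]. *)
Lemma qf_inv_cauchy_schwarz (b : 'cV[R]_L) : posdef V ->
  (y^T *m b) 0 0 ^+ 2 <= qf V y * qf (invmx V) b.
Proof.
move=> pV; have V0 x : 0 <= qf V x by rewrite (le_trans _ (posdef_sqn x pV))// sqn_ge0.
apply: sqr_le_of_discr; rewrite ?V0 ?qf_inv_ge0// => t.
have -> : qf V y - 2 * t * (y^T *m b) 0 0 + t ^+ 2 * qf (invmx V) b =
    qf V (y - t *: (invmx V *m b)).
  have [sV _ _] := pV.
  rewrite qf_invE//; set c := invmx V *m b.
  have -> : b = V *m c by rewrite /c mulKVmx// posdef_unit.
  have Tc : (y - t *: c)^T = y^T - t *: c^T by rewrite linearB/= linearZ.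
  have sc : (c^T *m V *m y) 0 0 = (y^T *m (V *m c)) 0 0.
    have -> : c^T *m V *m y = (y^T *m (V *m c))^T by rewrite !trmx_mul trmxK sV.
    by rewrite mxE.
  rewrite /qf Tc !mulmxBl !mulmxBr -!scalemxAl -!scalemxAr.
  move: sc; rewrite mulmxA !mxE => ->; ring.
exact: V0.
Qed.

(** Cauchy-Schwarz in [V] on each lag bounds the energy [Y] by [sqrt Y] times the sum of
    [g_s sqrt q_s]; after cancelling [sqrt Y], Cauchy-Schwarz over the lags separates the two sums.
    The [q_s] enter only through their sum, which is what allows averaging over lags. *)
Lemma ridge_energy_le_sum (T : nat) (rs : 'I_T -> 'cV[R]_M) (g q : 'I_T -> R) :
  posdef V -> r = \sum_s rs s -> (forall s, 0 <= g s) -> (forall s, 0 <= q s) ->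
  (forall s, qf (invmx V) (K^T *m rs s) <= g s ^+ 2 * q s) ->
  qf V y <= (\sum_s g s ^+ 2) * (\sum_s q s).
Proof.
move=> pV rE g0 q0 h; set Y := qf V y; set X := _ * _.
have Y0 : 0 <= Y by rewrite /Y (le_trans _ (posdef_sqn y pV))// sqn_ge0.
have le1 : Y <= \sum_s Num.sqrt Y * (g s * Num.sqrt (q s)).
  have YE : Y = \sum_s (y^T *m (K^T *m rs s)) 0 0.
    by rewrite /Y ridge_energy_dot rE !mulmx_sumr summxE.
  rewrite {1}YE; apply: ler_sum => s _.
  rewrite (le_trans (ler_norm _))// -(@ler_sqr _ `|_|) ?nnegrE ?mulr_ge0 ?sqrtr_ge0//.
  rewrite real_normK ?num_real// !exprMn !sqr_sqrtr//.
  apply: le_trans (qf_inv_cauchy_schwarz _ pV) _; exact: ler_wpM2l.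
rewrite -mulr_sumr in le1; set Z := \sum_s _ * _ in le1.
have Z2 : Z ^+ 2 <= X.
  apply: le_trans (cauchy_schwarz_sum _ _) _; rewrite ler_wpM2l//.
    by apply: sumr_ge0 => s _; exact: sqr_ge0.
  by apply: ler_sum => s _; rewrite sqr_sqrtr.
have Z0 : 0 <= Z by apply: sumr_ge0 => s _; rewrite mulr_ge0 ?sqrtr_ge0.
have := sqr_sqrtr Y0; have := sqrtr_ge0 Y; move: le1 Z2 Z0.
move: (Num.sqrt Y) => sY le1 Z2 Z0 sY0 sY2.
apply: le_trans Z2; rewrite -sY2 lerXn2r ?nnegrE//.
have [->//|sYn] := eqVneq sY 0.
have sYp : 0 < sY by rewrite lt_neqAle eq_sym sYn.
by rewrite -(ler_pM2l sYp) -expr2 sY2.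
Qed.

End Energy.
End Ridge.

(** * Lag decomposition, Gram matrices and scalar inequalities *)

Section Deterministic.
Variable R : realType.

Definition lag_block M T p (U : 'M[R]_(M, T * p)) (s : 'I_T) : 'M[R]_(M, p) :=
  \matrix_(i, l) U i (mxvec_index s l).

Lemma sum_mxvec T p (F : 'I_(T * p) -> R) :
  \sum_c F c = \sum_s \sum_l F (mxvec_index s l).
Proof.
rewrite pair_bigA (reindex _ (curry_mxvec_bij T p)).
by apply: eq_bigr => -[s l] _.
Qed.

Lemma mulmx_lag M T p (U : 'M[R]_(M, T * p)) (g : 'cV[R]_(T * p)) :
  U *m g = \sum_s lag_block U s *m (lag_block g^T s)^T.
Proof.
apply/matrixP => i j; rewrite (ord1 j) mxE summxE.
rewrite sum_mxvec.
by apply: eq_bigr => s _; rewrite mxE; apply: eq_bigr => l _; rewrite !mxE.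
Qed.

Lemma vnorm_lag T p (g : 'cV[R]_(T * p)) :
  \sum_s vnorm (lag_block g^T s)^T ^+ 2 = vnorm g ^+ 2.
Proof.
rewrite vnorm_sqr sum_mxvec.
by apply: eq_bigr => s _; rewrite vnorm_sqr; apply: eq_bigr => l _; rewrite !mxE.
Qed.

(** Puts the Gram matrix into the form of successive rank-one updates used by the martingale. *)
Lemma gramE M L (K : 'M[R]_(M, L)) :
  K^T *m K = \sum_(i < M) (row i K)^T *m ((row i K)^T)^T.
Proof.
apply/matrixP => a b; rewrite mxE summxE; apply: eq_bigr => i _.
by rewrite [RHS]mxE big_ord1 !mxE.
Qed.

Lemma trmx_mulE M L (K : 'M[R]_(M, L)) (b : 'cV[R]_M) :
  K^T *m b = \sum_(i < M) b i 0 *: (row i K)^T.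
Proof.
apply/matrixP => a j; rewrite (ord1 j) mxE summxE; apply: eq_bigr => i _.
by rewrite !mxE mulrC.
Qed.

Lemma posdef_gram M L (K : 'M[R]_(M, L)) : posdef (1%:M + K^T *m K).
Proof.
rewrite gramE; elim/big_rec: _ => [|i x _ IH]; first by rewrite addr0; exact: posdef1.
by rewrite addrCA addrC; exact: posdef_rank1.
Qed.

(** Jensen's inequality, from the tangent line of [ln] at the mean [b]: the terms [a s / b - 1] sum
    to zero. *)
Lemma sum_ln_le T (a : 'I_T -> R) : (0 < T)%N -> (forall s, 0 < a s) ->
  \sum_s ln (a s) <= T%:R * ln ((\sum_s a s) / T%:R).
Proof.
move=> T0 a0; have Tp : 0 < T%:R :> R by rewrite ltr0n.
have sp : 0 < \sum_s a s.
  case: T T0 a a0 Tp => // T _ a a0 _; rewrite big_ord_recl ltr_wpDr//.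
  by apply: sumr_ge0 => i _; exact: ltW.
set b := _ / _; have b0 : 0 < b by rewrite divr_gt0.
have h s : ln (a s) <= ln b + (a s / b - 1).
  rewrite -lerBlDl -ln_div ?posrE// -{1}[a s / b](subrKC 1); apply: le_ln1Dx.
  by rewrite ltrBrDl subrr divr_gt0.
apply: le_trans (ler_sum _ (fun s _ => h s)) _.
rewrite big_split/= sumr_const card_ord sumrB sumr_const card_ord -mulr_suml.
have -> : (\sum_s a s) / b = T%:R by rewrite /b invf_div mulrCA mulfV ?mulr1// gt_eqF.
by rewrite subrr addr0 mulr_natl.
Qed.

(** For [p = 1] the left side is 0, as it must be since [ptilde] vanishes when [T = 1]. For
    [p >= 2], [T p >= 2] gives [ln (T p) >= 1/2] and [ln (e T p) >= 1], so the minimum in [ptilde]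
    is at least 1/4. *)
Lemma pred_le_ptilde p T : (0 < p)%N -> (0 < T)%N -> p.-1%:R <= 4 * ptilde p T :> R.
Proof.
move=> p0 T0.
have Tp1 : 1 <= (T * p)%:R :> R by rewrite ler1n muln_gt0 T0.
have pt0 : 0 <= ptilde p T :> R.
  rewrite /ptilde mulr_ge0// le_min ler0n /= mulr_ge0// sqr_ge0//.
have [p1|p1] := leqP p 1.
  have -> : p.-1 = 0%N by case: p p1 {p0 Tp1 pt0} => [|[]].
  by rewrite mulr_ge0.
have lnTp : 2^-1 <= ln ((T * p)%:R : R).
  rewrite -ler_expR lnK ?posrE ?(lt_le_trans _ Tp1)//.
  apply: (@le_trans _ _ 2); last first.
    by rewrite ler_nat (leq_trans p1)// leq_pmull.
  (* [exp (1/2) <= 2], by inverting [exp (-1/2) >= 1 - 1/2]. *)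
  rewrite -[leLHS]invrK -expRN -[leRHS]invrK lef_pV2 ?posrE ?invr_gt0 ?expR_gt0//.
  by have := expR_ge1Dx (- 2^-1 : R); lra.
have lne : 1 <= ln (expR 1 * (T * p)%:R : R).
  by rewrite lnM ?posrE ?expR_gt0 ?(lt_le_trans _ Tp1)// expRK lerDl (le_trans _ lnTp)// invr_ge0.
apply: (@le_trans _ _ p%:R); first by rewrite ler_nat leq_pred.
rewrite /ptilde mulrCA ler_peMr//.
have h : 4^-1 <= Num.min (T%:R : R) (ln (expR 1 * (T * p)%:R) ^+ 2 * ln (T * p)%:R ^+ 2).
  rewrite le_min; apply/andP; split.
    have : 1 <= T%:R :> R by rewrite ler1n.
    lra.
  apply: (@le_trans _ _ (1 * 2^-1 ^+ 2)); first by rewrite mul1r expr2; lra.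
  apply: ler_pM => //; rewrite ?sqr_ge0//.
    by rewrite exprn_ege1.
  by rewrite lerXn2r ?nnegrE ?invr_ge0// (le_trans _ lnTp)// invr_ge0.
lra.
Qed.

End Deterministic.

(** * The pathwise bound on the ridge estimator *)

Section Pointwise.
Variable R : realType.

Definition mixture (I : finType) (c : I -> R) p L (V : 'M[R]_L) (X : 'M[R]_(L, p))
    (z : I -> 'cV[R]_p) : R :=
  \sum_i c i * selfnorm V (X *m z i).

Lemma qf_gram L p (W : 'M[R]_L) (X : 'M[R]_(L, p)) (x : 'cV[R]_p) :
  qf (X^T *m W *m X) x = qf W (X *m x).
Proof. by rewrite /qf trmx_mul !mulmxA. Qed.

(** Any single weighted term is below the mixture; on taking logarithms, the 1/2 in the exponent and
    the factor 4 of the net combine to 8. *)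
Lemma mixture_bound (I : finType) (c : I -> R) p L (V : 'M[R]_L)
    (X : 'M[R]_(L, p)) (z : I -> 'cV[R]_p) (x : 'cV[R]_p) (i : I) (e : R) :
  posdef V -> (forall i, 0 <= c i) -> expR (- e) <= c i ->
  qf (X^T *m invmx V *m X) x <= 4 * qf (X^T *m invmx V *m X) (z i) ->
  0 < mixture c V X z /\
  qf (invmx V) (X *m x) <= 8 * (ln (mixture c V X z) + ln (\det V) / 2 + e).
Proof.
move=> pV c0 ec; rewrite !qf_gram => h.
have le1 : expR (- e) * selfnorm V (X *m z i) <= mixture c V X z.
  apply: (@le_trans _ _ (c i * selfnorm V (X *m z i))).
    by rewrite ler_wpM2r// expR_ge0.
  rewrite /mixture (bigD1 i)//= lerDl sumr_ge0// => j _.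
  by rewrite mulr_ge0// expR_ge0.
have m0 : 0 < mixture c V X z by apply: lt_le_trans le1; rewrite mulr_gt0// expR_gt0.
split => //; move: le1; rewrite /selfnorm -expRD.
rewrite -{1}[mixture c V X z]lnK ?posrE// ler_expR.
move: h; move: (qf _ _) (qf _ _) (ln _) (ln _) => q1 q2 l1 l2; lra.
Qed.

Lemma qf_unit_scale L p (W : 'M[R]_L) (X : 'M[R]_(L, p)) (q : R) (x : 'cV[R]_p) :
  (forall y : 'cV[R]_p, \sum_j y j 0 ^+ 2 = 1 -> qf W (X *m y) <= q) ->
  qf W (X *m x) <= vnorm x ^+ 2 * q.
Proof.
move=> h; have [x0|x0] := eqVneq (vnorm x) 0.
  by rewrite x0 (vnorm_eq0 x0) mulmx0 /qf mulmx0 mxE expr0n mul0r.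
have xp : 0 < vnorm x ^+ 2 by rewrite exprn_gt0// lt_neqAle eq_sym x0 vnorm_ge0.
have := h ((vnorm x)^-1 *: x); rewrite -scalemxAr qfZ exprVn.
rewrite mulrC ler_pdivrMr// mulrC; apply.
by under eq_bigr do rewrite mxE exprMn exprVn; rewrite -mulr_sumr -vnorm_sqr mulVf ?gt_eqF.
Qed.

(** Holds outcome by outcome: besides the bound on [U^T U], the only trace of probability is the
    bound [T / delta] on the summed mixtures. *)
Lemma ridge_overfit (I : finType) (c : I -> R) p (z : I -> 'cV[R]_p) m T L M N
    (K : 'M[R]_(M, L)) (U : 'M[R]_(M, T * p)) (Gs : 'M[R]_(m, T * p)) (mu delta : R)
    (phi : 'M[R]_(m, L)) :
  let Kt := mu^-1 *: K in let V := 1%:M + Kt^T *m Kt in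
  (0 < p)%N -> (0 < m)%N -> (0 < T)%N -> 0 < mu -> 0 < delta < 1 ->
  (forall i, 0 <= c i) ->
  (forall (A : 'M[R]_p) (x : 'cV[R]_p), psd A -> \sum_j x j 0 ^+ 2 = 1 ->
      exists2 i, qf A x <= 4 * qf A (z i) & expR (- (12 * p.-1%:R)) <= c i) ->
  \sum_s mixture c V (Kt^T *m lag_block U s) z <= T%:R / delta ->
  loewner_le (U^T *m U) ((2 * N%:R)%:M) ->
  is_ridge K (U *m Gs^T) mu phi ->
  opnorm (K *m phi^T) <= 20 * Ovfit Gs N T p (K *m K^T) mu delta /\
  mu * opnorm phi^T <= 20 * Ovfit Gs N T p (K *m K^T) mu delta.
Proof.
move=> Kt V p0 m0 T0 mu0 /andP[d0 d1] c0 net hmix hU hr.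
have pV : posdef V by exact: posdef_gram.
have Tp : 0 < T%:R :> R by rewrite ltr0n.
(* Sylvester's identity exchanges the [M] by [M] determinant in [Ovfit] for that of the [L] by [L]
   matrix [V]. *)
have detE : \det (1%:M + mu ^- 2 *: (K *m K^T)) = \det V.
  rewrite /V -det_addmul_comm /Kt [(_ *: _)^T]linearZ/= -scalemxAl -scalemxAr scalerA.
  by rewrite -expr2 exprVn.
pose Om : R := ln (delta^-1) + ptilde p T + ln (Num.sqrt (\det V)).
have [_ _ det1] := pV.
have lnsq : ln (Num.sqrt (\det V)) = ln (\det V) / 2.
  rewrite -[in RHS](@sqr_sqrtr _ (\det V)) ?(le_trans _ det1)//.
  rewrite lnXn ?sqrtr_gt0 ?(lt_le_trans _ det1)//.
  by rewrite -[ln _ *+ 2]mulr_natr mulfK.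
have lnd0 : 0 <= ln (\det V) by exact: ln_ge0.
have lndel : 0 <= ln (delta^-1) by rewrite ln_ge0// invf_ge1// ltW.
have pt := @pred_le_ptilde R p T p0 T0.
have pt0 : 0 <= ptilde p T :> R.
  by have : 0 <= p.-1%:R :> R := ler0n _ _; lra.
have Om0 : 0 <= Om by rewrite /Om lnsq; lra.
pose a s := mixture c V (Kt^T *m lag_block U s) z.
pose q s := 8 * (ln (a s) + ln (\det V) / 2 + 12 * p.-1%:R).
have psdA (X : 'M[R]_(L, p)) : psd (X^T *m invmx V *m X).
  by move=> x; rewrite -/(qf _ _) qf_gram; exact: qf_inv_ge0.
have qP s (y : 'cV[R]_p) : \sum_j y j 0 ^+ 2 = 1 ->
    0 < a s /\ qf (invmx V) (Kt^T *m lag_block U s *m y) <= q s.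
  move=> y1; have [i h1 h2] := net _ _ (psdA (Kt^T *m lag_block U s)) y1.
  exact: (mixture_bound pV c0 h2 h1).
have [e0 e01] : exists y : 'cV[R]_p, \sum_j y j 0 ^+ 2 = 1.
  case: p p0 {U Gs z hmix hU hr net pt pt0 Om Om0 a q psdA qP} => // p _.
  exists (delta_mx 0 0); rewrite (bigD1 ord0)//= big1 => [|j /negbTE j0].
    by rewrite mxE eqxx expr1n addr0.
  by rewrite mxE j0 expr0n.
have a0 s : 0 < a s by have [] := qP s e0 e01.
have q0 s : 0 <= q s.
  by have [_ h] := qP s e0 e01; rewrite (le_trans _ h)// qf_inv_ge0.
(* Jensen's inequality bounds the average of [ln (a s)] by [ln (1 / delta)]; the constant is
   [8 * 12 * 4], from the coefficient of [ptilde]. *)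
have sumq : \sum_s q s <= 384 * (T%:R * Om).
  rewrite /q -mulr_sumr !big_split/= !sumr_const !card_ord.
  have lnb : ln ((\sum_s a s) / T%:R) <= ln (delta^-1).
    rewrite ler_ln ?posrE ?invr_gt0//; last first.
      rewrite divr_gt0//; case: T T0 {Tp U Gs hmix hU hr Om Om0 pt pt0 q qP q0} a a0 => // T _ a a0.
      rewrite big_ord_recl ltr_wpDr//.
      by apply: sumr_ge0 => i _; exact: ltW.
    by rewrite ler_pdivrMr// mulrC.
  have := sum_ln_le T0 a0.
  rewrite -[_ / 2 *+ T]mulr_natl -[_ * _ *+ T]mulr_natl => h.
  have h2 : T%:R * ln ((\sum_s a s) / T%:R) <= T%:R * ln (delta^-1) by rewrite ler_pM2l.
  have h3 : T%:R * p.-1%:R <= T%:R * (4 * ptilde p T) :> R by exact: (ler_wpM2l (ltW Tp) pt).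
  have h4 : 0 <= T%:R * ln (delta^-1) by rewrite mulr_ge0// ltW.
  have h5 : 0 <= T%:R * ln (\det V) by rewrite mulr_ge0// ltW.
  have h6 : 0 <= T%:R * ptilde p T :> R by rewrite mulr_ge0// ltW.
  rewrite /Om lnsq; move: h h2 h3 h4 h5 h6.
  move: (\sum_s ln (a s)) => S1; rewrite !mulrDr !mulrA.
  lra.
have mun : mu != 0 by rewrite gt_eqF.
have KtE (x : 'cV[R]_m) : Kt *m (mu *: (phi^T *m x)) = K *m phi^T *m x.
  by rewrite /Kt -scalemxAl -scalemxAr scalerA mulVf// scale1r mulmxA.
(* Both norms in the conclusion have squares below the energy of [y = mu phi^T x], so one bound on
   such [X] treats them together. *)
have key (x : 'cV[R]_m) : vnorm x = 1 ->
    forall X, 0 <= X -> X ^+ 2 <= qf V (mu *: (phi^T *m x)) ->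
    X <= 20 * Ovfit Gs N T p (K *m K^T) mu delta.
  move=> x1 X X0 hX; set y := mu *: (phi^T *m x) in hX.
  set g := Gs^T *m x; have gG : vnorm g <= opnorm Gs.
    by have := vnorm_trmx_mul_le Gs x; rewrite x1 mulr1.
  have G0 := opnorm_ge0 Gs; have g0 := vnorm_ge0 g.
  have Vy : V *m y = Kt^T *m (U *m g).
    have := ridge_normal_eq hr => /(congr1 (fun A => mu^-1 *: (A *m x))).
    rewrite mulmxDl scalerDr -scalemxAl scalerA expr2 mulrA mulVf ?gt_eqF// mul1r => E.
    rewrite /V mulmxDl mul1mx -mulmxA KtE.
    have -> : Kt^T = mu^-1 *: K^T by rewrite /Kt linearZ.
    rewrite -!scalemxAl !mulmxA addrC.
    by move: E; rewrite !mulmxA => ->.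
  clearbody g.
  have B1 : qf V y <= 2 * N%:R * opnorm Gs ^+ 2.
    apply: le_trans (ridge_energy_le_norm Vy) _.
    have E1 : (g^T *m (U^T *m U) *m g) 0 0 = vnorm (U *m g) ^+ 2.
      by rewrite vnorm_sqrE trmx_mul !mulmxA.
    have E2 : (g^T *m (2 * N%:R)%:M *m g) 0 0 = 2 * N%:R * vnorm g ^+ 2.
      by rewrite mul_mx_scalar -scalemxAl mxE vnorm_sqrE.
    have := hU g; rewrite mulmxBr mulmxBl mxE [X in _ + X]mxE E1 E2 subr_ge0 => h.
    apply: le_trans h _.
    by rewrite ler_wpM2l ?mulr_ge0// lerXn2r ?nnegrE.
  have B2 : qf V y <= opnorm Gs ^+ 2 * (384 * (T%:R * Om)).
    have rE := mulmx_lag U g.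
    have := ridge_energy_le_sum Vy pV rE (g := fun s => vnorm (lag_block g^T s)^T) (q := q).
    rewrite vnorm_lag => h; apply: le_trans (h _ q0 _) _.
    - by move=> s; exact: vnorm_ge0.
    - move=> s; rewrite mulmxA; apply: qf_unit_scale => v v1.
      by have [] := qP s v v1.
    - apply: ler_pM => //; rewrite ?sqr_ge0 ?sumr_ge0//.
      by rewrite lerXn2r ?nnegrE.
  (* Each branch of the minimum is an upper bound by itself; 20 suffices because [20^2 = 400]
     exceeds both 2 and 384. *)
  rewrite /Ovfit detE -/Om /Num.min; case: ifP => _.
  - rewrite -(@ler_sqr _ X) ?nnegrE ?mulr_ge0 ?sqrtr_ge0//.
    rewrite (le_trans hX)// (le_trans B1)// !exprMn sqr_sqrtr//.
    have := sqr_ge0 (opnorm Gs); have : 0 <= N%:R :> R by [].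
    move: (N%:R) (opnorm Gs ^+ 2) => n o n0 o0; have := mulr_ge0 n0 o0; lra.
  - rewrite -(@ler_sqr _ X) ?nnegrE ?mulr_ge0 ?sqrtr_ge0//.
    rewrite (le_trans hX)// (le_trans B2)// !exprMn !sqr_sqrtr//.
    have := sqr_ge0 (opnorm Gs); have := mulr_ge0 (ltW Tp) Om0.
    move: (T%:R * Om) (opnorm Gs ^+ 2) => n o n0 o0; have := mulr_ge0 n0 o0; lra.
split.
  apply: opnorm_le => // x x1; apply: (key x x1); first exact: vnorm_ge0.
  by rewrite ridge_energyE KtE lerDr sqr_ge0.
rewrite mulrC -ler_pdivlMr//; apply: opnorm_le => // x x1.
rewrite ler_pdivlMr// mulrC; apply: (key x x1); first by rewrite mulr_ge0 ?vnorm_ge0// ltW.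
by rewrite ridge_energyE vnormZ gtr0_norm// lerDl sqr_ge0.
Qed.

End Pointwise.

(** * The high-probability event *)

Lemma markov_complement (R : realType) (d : measure_display) (Omega : measurableType d)
    (P : probability Omega R) (X : Omega -> R) (a delta : R) :
  measurable_fun setT X -> (forall w, 0 <= X w) -> 0 < a -> 0 < delta ->
  (\int[P]_w (X w)%:E <= a%:E)%E ->
  measurable [set w | X w <= a / delta] /\
  ((1 - delta)%:E <= P [set w | (X w <= a / delta)%R])%E.
Proof.
move=> mX X0 a0 d0 EX.
have mS : measurable [set w | X w <= a / delta].
  have -> : [set w | X w <= a / delta] = X @^-1` `]-oo, a / delta].
    by apply/seteqP; split => w /=; rewrite in_itv.
  by rewrite -[X in measurable X]setTI; exact: mX.
split => //; set S := [set w | _].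
have ad0 : 0 < a / delta by rewrite divr_gt0.
have h := le_integral_abse P measurableT (proj2 (measurable_EFinP _ _) mX) ad0.
have {}h : ((a / delta)%:E * P (~` S) <= a%:E)%E.
  apply: le_trans (le_trans h _).
    rewrite lee_wpmul2l ?lee_fin ?(ltW ad0)//; apply: le_measure; rewrite ?inE.
    - exact: measurableC.
    - rewrite setTI; have -> : [set x | ((a / delta)%:E <= `|(EFin \o X) x|)%E] =
          X @^-1` `[a / delta, +oo[.
        by apply/seteqP; split => w /=; rewrite in_itv /= andbT lee_fin ger0_norm.
      by rewrite -[X in measurable X]setTI; exact: mX.
    - move=> w /= /negP; rewrite -ltNge => /ltW; split => //=.
      by rewrite lee_fin ger0_norm.
  rewrite (eq_integral (fun w => (X w)%:E))// => w _.
  by rewrite /= ger0_norm.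
have := probability_setC P mS => PE; rewrite PE in h.
have Pfin : P S \is a fin_num by exact: fin_num_measure.
rewrite -(fineK Pfin) in h *.
move: h; rewrite -EFinB -EFinM !lee_fin => h.
have : 1 - fine (P S) <= delta.
  rewrite -(ler_pM2l ad0) (le_trans h)// divfK// gt_eqF//.
lra.
Qed.

Section Expectation.
Context {R : realType} {d : measure_display} {Omega : measurableType d}.
Variable P : probability Omega R.

Lemma lag_block_Ubar p (u : int -> Omega -> 'rV[R]_p) T N1 N w (s : 'I_T) i l :
  lag_block (Ubar u T N1 N w) s i l = u ((N1 + i)%:Z - s%:Z) w 0 l.
Proof. by rewrite !mxE mxvecE mxE. Qed.

Variables (p T L N1 N : nat) (F : int -> set (set Omega)).
Variables (u : int -> Omega -> 'rV[R]_p) (k : int -> Omega -> 'rV[R]_L) (mu : R).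
Hypothesis filtF : filtration F.
Hypothesis uF : forall t l, Gmeas (F t) (fun w => u t w 0 l).
Hypothesis ucond : forall t, cond_std_gauss P (F (t - 1)) (u t).
Hypothesis kF : forall t l, Gmeas (F (t - T%:Z)) (fun w => k t w 0 l).

Let Kt w := mu^-1 *: Kmat k N1 N w.
Let V w := 1%:M + (Kt w)^T *m Kt w.

(** For a fixed lag [s], the noise at time [N1 + i - s] is standard given [G i], the past up to one
    step before. The feature at time [N1 + i] is already known at [N1 + i - T], which is no later
    because [s + 1 <= T]. *)
Lemma integral_selfnorm_lag (s : 'I_T) (z : 'cV[R]_p) : \sum_j z j 0 ^+ 2 = 1 ->
  (\int[P]_w (selfnorm (V w) ((Kt w)^T *m lag_block (Ubar u T N1 N w) s *m z))%:E = 1)%E.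
Proof.
move=> z1; have [sF [Fm Fle]] := filtF.
pose G i := F ((N1 + i)%:Z - s%:Z - 1).
pose v i := u ((N1 + i)%:Z - s%:Z).
pose kk i w : 'cV[R]_L := mu^-1 *: (k (N1 + i)%:Z w)^T.
have GS i : F ((N1 + i)%:Z - s%:Z) = G i.+1.
  by congr F; rewrite addnS intS; ring.
have Gcond i : cond_std_gauss P (G i) (v i) by exact: ucond.
have GSub i : G i `<=` G i.+1.
  by rewrite -GS; apply: Fle; rewrite lerBlDr lerDl.
have vG i j : Gmeas (G i.+1) (fun w => v i w 0 j) by rewrite -GS; exact: uF.
have kG i : mxGmeas (G i) (kk i).
  apply/(mxGmeasP _ (sF _)); apply: mxmeasZ; first exact: measurable_cst.
  apply: mxmeas_tr; apply/(mxGmeasP _ (sF _)) => a b; rewrite (ord1 a) => B mB.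
  apply: (Fle ((N1 + i)%:Z - T%:Z)); last exact: kF.
  by rewrite -addrA lerD2l -opprD lerN2 -[1]/(1%:Z) -PoszD lez_nat addn1.
apply: eq_trans (integral_selfnorm (fun i => sF _) (fun i => Fm _) GSub Gcond vG kG z1
  (N - N1).+1).
have rowE w (i : 'I_(N - N1).+1) : (row i (Kt w))^T = kk i w.
  by apply/matrixP => a b; rewrite /Kt /kk (ord1 b) !mxE.
apply: eq_integral => w _.
have -> : V w = 1%:M + \sum_(i < (N - N1).+1) kk i w *m (kk i w)^T.
  by rewrite /V gramE; congr (_ + _); apply: eq_bigr => i _; rewrite rowE.
rewrite -mulmxA trmx_mulE.
have -> : \sum_i (lag_block (Ubar u T N1 N w) s *m z) i 0 *: (row i (Kt w))^T =
    \sum_(i < (N - N1).+1) (\sum_j v i w 0 j * z j 0) *: kk i w; last by [].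
apply: eq_bigr => i _; rewrite rowE mxE.
by under eq_bigr do rewrite lag_block_Ubar.
Qed.

Lemma measurable_selfnorm_lag (s : 'I_T) (z : 'cV[R]_p) :
  measurable_fun setT
    (fun w => selfnorm (V w) ((Kt w)^T *m lag_block (Ubar u T N1 N w) s *m z)).
Proof.
have [sF [Fm Fle]] := filtF.
have mK : mxmeas Kt.
  apply: mxmeasZ; first exact: measurable_cst.
  move=> i j; under eq_fun do rewrite mxE.
  exact: (Gmeas_measurable (Fm _) (kF _ _)).
apply: measurable_selfnorm.
- by move=> w; exact: posdef_gram.
- by apply: mxmeasD; [exact: mxmeas_cst|apply: mxmeasM => //; exact: mxmeas_tr].
- apply: mxmeasM; last exact: mxmeas_cst.
  apply: mxmeasM; first exact: mxmeas_tr.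
  move=> i l; under eq_fun do rewrite lag_block_Ubar.
  exact: (Gmeas_measurable (Fm _) (uF _ _)).
Qed.

(** Each lag's mixture has expectation at most the total weight, so at most 1; the sum has
    expectation at most [T], and a single use of Markov's inequality at level [T / delta] loses
    [delta]. *)
Lemma mixture_event (I : finType) (c : I -> R) (z : I -> 'cV[R]_p) (delta : R) :
  (forall i, \sum_j z i j 0 ^+ 2 = 1) -> (forall i, 0 <= c i) -> \sum_i c i <= 1 ->
  (0 < T)%N -> 0 < delta ->
  let S := [set w | \sum_s mixture c (V w)
    ((Kt w)^T *m lag_block (Ubar u T N1 N w) s) z <= T%:R / delta] in
  measurable S /\ ((1 - delta)%:E <= P S)%E.
Proof.
move=> z1 c0 c1 T0 d0 S.
have mmix s : measurable_fun setT (fun w => mixture c (V w)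
    ((Kt w)^T *m lag_block (Ubar u T N1 N w) s) z).
  apply: measurable_sum => i; apply: measurable_funM; first exact: measurable_cst.
  exact: measurable_selfnorm_lag.
have mix0 s w : 0 <= mixture c (V w) ((Kt w)^T *m lag_block (Ubar u T N1 N w) s) z.
  by apply: sumr_ge0 => i _; rewrite mulr_ge0// expR_ge0.
apply: markov_complement => //.
- exact: measurable_sum.
- by move=> w; exact: sumr_ge0.
- by rewrite ltr0n.
under eq_integral do rewrite -sumEFin.
rewrite ge0_integral_sum//; last 2 first.
- by move=> s; exact/measurable_EFinP.
- by move=> s w _; rewrite lee_fin.
have -> : T%:R%:E = (\sum_(s < T) 1%:E)%E :> \bar R.
  by rewrite sumEFin sumr_const card_ord.
apply: lee_sum => s _; rewrite /mixture.
under eq_integral do rewrite -sumEFin.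
rewrite ge0_integral_sum//; last 2 first.
- move=> i; apply/measurable_EFinP; apply: measurable_funM; first exact: measurable_cst.
  exact: measurable_selfnorm_lag.
- by move=> i w _; rewrite lee_fin mulr_ge0// expR_ge0.
apply: (@le_trans _ _ (\sum_i (c i)%:E)%E); last by rewrite sumEFin lee_fin.
apply: lee_sum => i _; under eq_integral do rewrite EFinM.
rewrite ge0_integralZl//.
- by rewrite integral_selfnorm_lag// mule1.
- by apply/measurable_EFinP; exact: measurable_selfnorm_lag.
- by move=> w _; rewrite lee_fin expR_ge0.
- by rewrite lee_fin.
Qed.

End Expectation.

Theorem lemma6 (R : realType) :
  exists C : R, 0 < C /\
  forall (p m T L N1 N : nat), (0 < p)%N -> (0 < m)%N -> (0 < T)%N -> (0 < L)%N ->
  (1 <= N1)%N -> (N1 <= N)%N ->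
  forall (d : measure_display) (Omega : measurableType d) (P : probability Omega R)
    (F : int -> set (set Omega)) (u : int -> Omega -> 'rV[R]_p)
    (k : int -> Omega -> 'rV[R]_L) (Gs : 'M[R]_(m, T * p)) (mu delta : R),
  filtration F ->
  (forall t l, Gmeas (F t) (fun w => u t w 0 l)) ->
  (forall t, cond_std_gauss P (F (t - 1)%R) (u t)) ->
  (forall t l, Gmeas (F (t - T%:Z)%R) (fun w => k t w 0 l)) ->
  0 < mu -> 0 < delta < 1 ->
  exists S : set Omega, measurable S /\ ((1 - delta)%:E <= P S)%E /\
    forall w, S w ->
      loewner_le ((N%:R / 2) %:M) ((Ubar u T N1 N w)^T *m Ubar u T N1 N w) ->
      loewner_le ((Ubar u T N1 N w)^T *m Ubar u T N1 N w) ((2 * N%:R) %:M) ->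
      forall phi : 'M[R]_(m, L),
        is_ridge (Kmat k N1 N w) (Ubar u T N1 N w *m Gs^T) mu phi ->
        opnorm (Kmat k N1 N w *m phi^T)
          <= C * Ovfit Gs N T p (Kmat k N1 N w *m (Kmat k N1 N w)^T) mu delta /\
        mu * opnorm phi^T
          <= C * Ovfit Gs N T p (Kmat k N1 N w *m (Kmat k N1 N w)^T) mu delta.
Proof.
exists 20; split=> // p m T L N1 N p0 m0 T0 L0 _ _ d Omega P F u k Gs mu delta.
move=> filtF uF ucond kF mu0 d01; have /andP[d0 _] := d01.
have [I [z [c [z1 c0 c1 net]]]] := @sphere_net R p p0.
have [mS PS] := @mixture_event R d Omega P p T L N1 N F u k mu filtF uF ucond kF
  I c z delta z1 c0 c1 T0 d0.
eexists; split; first exact: mS.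
split => // w Sw _ hU phi; exact: (ridge_overfit p0 m0 T0 mu0 d01 c0 net Sw hU).
Qed.
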